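(* (Omitting Types Theorem for Gurarij spaces.) Let $E$ be a separable Banach space, and assume we are given, for each $n \in \mathbb{N}$, a set $X_n \subseteq S_n(E)$ that is metrically open (open for the distance $d$) and topologically meagre (meagre in the topology of $S_n(E)$). Then there exists a separable Gurarij space $G \supseteq E$ such that in addition, for every $n$, no type in $X_n$ is realised in $G$ (one says that $G$ omits all $X_n$). Moreover, the set of Gurarij types in $S_{\mathbb{N}}(E)$ that generate such spaces is co-meagre in $S_{\mathbb{N}}(E)$.
   Context: All spaces are real; inclusions and embeddings of normed spaces are linear and isometric. Types. For a Banach space $E$ and an index set $I$ (in particular $I = n = \{0,\ldots,n-1\}$ or $I = \mathbb{N}$), let $E(I) = E \oplus \bigoplus_{i\in I} \mathbb{R} x_i$, with formal variables $x_i$. $S_I(E)$ is the set of all semi-norms on $E(I)$ extending the norm of $E$; the semi-norm corresponding to $\xi$ is written $\|\cdot\|^\xi$. If $E \subseteq F$ are Banach spaces and $\bar a \in F^I$, then $\mathrm{tp}(\bar a/E) \in S_I(E)$ is the semi-norm $b + \sum \lambda_i x_i \mapsto \| b + \sum \lambda_i a_i \|$; $\bar a$ realises $\xi$ if $\xi = \mathrm{tp}(\bar a/E)$. The topology on $S_I(E)$ is the least one making $\xi \mapsto \|x\|^\xi$ continuous for every $x \in E(I)$. For finite $n$, the distance $d(\xi,\zeta)$ on $S_n(E)$ is the infimum, over all Banach spaces $F \supseteq E$ and all realisations $\bar a,\bar b \in F^n$ of $\xi,\zeta$ respectively, of $\sup_i \|a_i - b_i\|$. For $\xi \in S_I(E)$,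 the generated space $E[\xi]$ is the Banach space extension of $E$ obtained from $(E(I),\|\cdot\|^\xi)$ by dividing by the kernel and completing. A type $\xi \in S_{\mathbb{N}}(E)$ is a Gurarij type if $E[\xi]$ is a Gurarij space. A Gurarij space is a Banach space $G$ such that for any $\varepsilon > 0$, finite-dimensional Banach spaces $E \subseteq F$ and isometric embedding $\varphi \colon E \to G$, there is a linear map $\psi \colon F \to G$ extending $\varphi$ with $(1-\varepsilon)\|x\| \leq \|\psi x\| \leq (1+\varepsilon)\|x\|$ for all $x \in F$. *)

(* Defs.v *)
From HB Require Import structures.
From mathcomp Require Import all_boot all_order all_algebra finmap.
From mathcomp Require Import all_classical all_reals all_analysis.
From mathcomp Require Import lra.
From mathcomp Require monalg.
(* The notations of [monalg] clash with those of the analysis library. *)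
Import -(notations) monalg.
Import Order.TTheory GRing.Theory Num.Theory.
Import numFieldNormedType.Exports.

Set Implicit Arguments.
Unset Strict Implicit.
Unset Printing Implicit Defensive.

Local Open Scope classical_set_scope.
Local Open Scope ring_scope.
Local Open Scope quotient_scope.

Record seminorm (R : realType) (V : lmodType R) := Seminorm {
  seminorm_fun :> V -> R ;
  seminormD : forall x y, seminorm_fun (x + y) <= seminorm_fun x + seminorm_fun y ;
  seminormZ : forall (a : R) x, seminorm_fun (a *: x) = `|a| * seminorm_fun x }.

Section SeminormTheory.
Variables (R : realType) (V : lmodType R) (p : seminorm V).

Lemma seminorm0 : p 0 = 0.
Proof. by rewrite -(scale0r 0) seminormZ normr0 mul0r. Qed.

Lemma seminormN x : p (- x) = p x.
Proof. by rewrite -scaleN1r seminormZ normrN1 mul1r. Qed.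

Lemma seminorm_ge0 x : 0 <= p x.
Proof.
have := seminormD p x (- x); rewrite subrr seminorm0 seminormN -mulr2n.
by rewrite pmulrn_lge0.
Qed.

Lemma seminorm_distC x y : p (x - y) = p (y - x).
Proof. by rewrite -seminormN opprB. Qed.

Lemma seminorm_dist x y : `|p x - p y| <= p (x - y).
Proof.
rewrite ler_norml; apply/andP; split.
  rewrite lerNl opprB lerBlDr seminorm_distC.
  by have := seminormD p (y - x) x; rewrite subrK.
by rewrite lerBlDr; have := seminormD p (x - y) y; rewrite subrK.
Qed.

Lemma seminorm_triangle x y z : p (x - z) <= p (x - y) + p (y - z).
Proof. by have := seminormD p (x - y) (y - z); rewrite addrA subrK. Qed.

End SeminormTheory.

(* The Banach space obtained from a semi-normed space by dividing by the
   kernel of the semi-norm and completing, done in one step: Cauchy sequences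
   modulo the sequences whose semi-norm tends to 0. *)
Section Completion.
Variables (R : realType) (V : lmodType R) (p : seminorm V).

Definition cauchy_seq (u : nat -> V) : Prop :=
  forall e, 0 < e -> exists N, forall m n,
    (N <= m)%N -> (N <= n)%N -> p (u m - u n) < e.

Definition cauchy_seqb : {pred (nat -> V)} := fun u => `[< cauchy_seq u >].

Lemma cauchy_seqb_closed : submod_closed cauchy_seqb.
Proof.
split.
  apply/asboolP => e e0; exists 0%N => m n _ _.
  by rewrite [X in p X]subrr seminorm0.
move=> a u v /asboolP cu /asboolP cv; apply/asboolP => e e0.
have a0 : 0 < `|a| + 1 by rewrite ltr_wpDl.
have [N uN] := cu (e / 2 / (`|a| + 1)) ltac:(by rewrite !divr_gt0).
have [M vM] := cv (e / 2) ltac:(by rewrite divr_gt0).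
exists (maxn N M) => m n; rewrite !geq_max => /andP[Nm Mm] /andP[Nn Mn].
have -> : (a *: u + v) m - (a *: u + v) n
        = a *: (u m - u n) + (v m - v n).
  by rewrite !fctE scalerBr addrACA opprD.
rewrite (le_lt_trans (seminormD _ _ _))// [ltRHS]splitr ltr_leD//; last first.
  exact/ltW/vM.
rewrite seminormZ (@le_lt_trans _ _ ((`|a| + 1) * p (u m - u n)))//.
  by rewrite ler_wpM2r ?seminorm_ge0// lerDl.
by rewrite mulrC -ltr_pdivlMr// uN.
Qed.

HB.instance Definition _ :=
  GRing.isSubmodClosed.Build R (nat -> V) cauchy_seqb cauchy_seqb_closed.

Record cauchy_space := CauchySpace {
  cauchy_val :> nat -> V ;
  cauchy_valP : cauchy_val \in cauchy_seqb }.

HB.instance Definition _ := [isSub for cauchy_val].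
HB.instance Definition _ := [Choice of cauchy_space by <:].
HB.instance Definition _ := [SubChoice_isSubLmodule of cauchy_space by <:].

Definition null_seqb : {pred cauchy_space} :=
  fun u => `[< p (cauchy_val u n) @[n --> \oo] --> (0 : R) >].

Lemma null_seqb_closed : submod_closed null_seqb.
Proof.
split.
  apply/asboolP; rewrite (_ : (fun n => _) = cst 0); first exact: cvg_cst.
  by apply/funext => n; exact: seminorm0.
move=> a u v /asboolP u0 /asboolP v0; apply/asboolP.
apply: (@squeeze_cvgr _ _ _ _ (cst 0)
    (fun n => `|a| * p (cauchy_val u n) + p (cauchy_val v n))).
- apply: nearW => n; rewrite seminorm_ge0 /=.
  by rewrite (le_trans (seminormD _ _ _))// seminormZ.
- exact: cvg_cst.
- rewrite -[0 in X in _ --> X](addr0 (0 : R)) -[X in X + _](mulr0 `|a|).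
  by apply: cvgD => //; exact: cvgMr.
Qed.

HB.instance Definition _ :=
  GRing.isSubmodClosed.Build R cauchy_space null_seqb null_seqb_closed.

Definition completion : Type := Quotient.quot null_seqb.
HB.instance Definition _ := Choice.on completion.
HB.instance Definition _ := GRing.Zmodule.on completion.

Definition completion_pi (u : cauchy_space) : completion :=
  \pi_(Quotient.quot null_seqb) u.

Lemma completion_piP (x : completion) : exists u, x = completion_pi u.
Proof. by exists (repr x); rewrite /completion_pi reprK. Qed.

Lemma completion_pi_eq u v :
  completion_pi u = completion_pi v <-> u - v \in null_seqb.
Proof.
rewrite (Quotient.idealrBE null_seqb u v).
by split => [/eqP//|/eqP].
Qed.

Lemma completion_piB : {morph completion_pi : u v / u - v}.
Proof. exact: raddfB. Qed.

Lemma completion_piD : {morph completion_pi : u v / u + v}.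
Proof. exact: raddfD. Qed.

Definition completion_scale (a : R) (x : completion) : completion :=
  completion_pi (a *: repr x).

Lemma completion_piZ a u :
  completion_scale a (completion_pi u) = completion_pi (a *: u).
Proof.
apply/completion_pi_eq; rewrite -scalerBr rpredZ//.
by apply/completion_pi_eq; rewrite /completion_pi reprK.
Qed.

Lemma completion_scaleA a b x :
  completion_scale a (completion_scale b x) = completion_scale (a * b) x.
Proof. by have [u ->] := completion_piP x; rewrite !completion_piZ scalerA. Qed.

Lemma completion_scale1 : left_id 1 completion_scale.
Proof.
by move=> x; have [u ->] := completion_piP x; rewrite completion_piZ scale1r.
Qed.

Lemma completion_scaleDr : right_distributive completion_scale +%R.
Proof.
move=> a x y; have [u ->] := completion_piP x; have [v ->] := completion_piP y.
by rewrite !completion_piZ -!completion_piD completion_piZ scalerDr.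
Qed.

Lemma completion_scaleDl x :
  {morph completion_scale^~ x : a b / a + b}.
Proof.
move=> a b; have [u ->] := completion_piP x.
by rewrite !completion_piZ -completion_piD scalerDl.
Qed.

HB.instance Definition _ := GRing.Zmodule_isLmodule.Build R completion
  completion_scaleA completion_scale1 completion_scaleDr completion_scaleDl.

Lemma completion_piZE a u : completion_pi (a *: u) = a *: completion_pi u.
Proof. exact/esym/completion_piZ. Qed.

Lemma is_cvg_seminorm (u : cauchy_space) : cvgn (fun n => p (u n)).
Proof.
apply/cauchy_cvgP/cauchy_exP => e e0.
have /asboolP/(_ e e0)[N uN] := cauchy_valP u.
exists (p (u N)); exists N => // n /= Nn.
by apply: (le_lt_trans (seminorm_dist _ _ _)); exact: uN.
Qed.

Definition completion_norm (x : completion) : R :=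
  limn (fun n => p (cauchy_val (repr x) n)).

Lemma completion_norm_cvg u :
  p (cauchy_val u n) @[n --> \oo] --> completion_norm (completion_pi u).
Proof.
set v : cauchy_space := repr (completion_pi u).
have /asboolP uv : u - v \in null_seqb.
  by apply/completion_pi_eq; rewrite /completion_pi reprK.
have cv : p (v n) @[n --> \oo] --> completion_norm (completion_pi u).
  exact: is_cvg_seminorm.
have uv0 : (p (u n) - p (v n)) @[n --> \oo] --> (0 : R).
  apply/cvgr0Pnorm_le => e e0; move/cvgr0Pnorm_le : uv => /(_ e e0).
  apply: filterS => n /= uve; apply: le_trans uve.
  exact: le_trans (seminorm_dist _ _ _) (ler_norm _).
rewrite (_ : (fun n => _) = (fun n => p (u n) - p (v n)) + (fun n => p (v n))).
  by rewrite -[X in _ --> X]add0r; exact: cvgD.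
by apply/funext => n; rewrite !fctE subrK.
Qed.

Lemma completion_normE u :
  completion_norm (completion_pi u) = limn (fun n => p (cauchy_val u n)).
Proof. exact/esym/cvg_lim/completion_norm_cvg. Qed.

Lemma completion_normD x y :
  completion_norm (x + y) <= completion_norm x + completion_norm y.
Proof.
have [u ->] := completion_piP x; have [v ->] := completion_piP y.
rewrite -completion_piD.
apply: (@ler_cvg_to _ (\oo : set_system nat) _ _
  (fun n => p (cauchy_val (u + v) n))
  (fun n => p (cauchy_val u n) + p (cauchy_val v n))).
- exact: completion_norm_cvg.
- apply: cvgD; exact: completion_norm_cvg.
- by apply: nearW => n; exact: seminormD.
Qed.

Lemma completion_normZ (a : R) x :
  completion_norm (a *: x) = `|a| * completion_norm x.
Proof.
have [u ->] := completion_piP x; rewrite -completion_piZE completion_normE.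
apply: cvg_lim => //.
rewrite (_ : (fun n => _) = (fun n => `|a| * p (cauchy_val u n))).
  by apply: cvgMr; exact: completion_norm_cvg.
by apply/funext => n; exact: seminormZ.
Qed.

Lemma completion_norm_eq0 x : completion_norm x = 0 -> x = 0.
Proof.
have [u ->] := completion_piP x => u0.
rewrite -(subrr (completion_pi 0)) -completion_piB; apply/completion_pi_eq.
by rewrite subr0 subr0; apply/asboolP; rewrite -u0; exact: completion_norm_cvg.
Qed.

HB.instance Definition _ := Lmodule_isNormed.Build R completion
  completion_normD completion_normZ completion_norm_eq0.

Lemma cauchy_cst (x : V) : (fun=> x) \in cauchy_seqb.
Proof.
apply/asboolP => e e0; exists 0%N => m n _ _.
by rewrite subrr seminorm0.
Qed.

Definition completion_map (x : V) : completion :=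
  completion_pi (CauchySpace (cauchy_cst x)).

Lemma completion_map_is_linear : linear completion_map.
Proof.
move=> a x y; rewrite /completion_map -completion_piZE -completion_piD.
by congr completion_pi; exact/val_inj.
Qed.

HB.instance Definition _ := GRing.isLinear.Build R V completion _
  completion_map completion_map_is_linear.

Lemma completion_map_norm x : `|completion_map x| = p x.
Proof.
rewrite -[LHS]/(completion_norm _) completion_normE.
by apply: (@cvg_lim _ (@norm_hausdorff _ R)); exact: (@cvg_cst _ (p x)).
Qed.

Lemma completion_pi_approx (u : cauchy_space) (e : R) N :
  (forall n, (N <= n)%N -> p (u n - u N) <= e) ->
  `|completion_pi u - completion_map (u N)| <= e.
Proof.
move=> ue; rewrite /completion_map -completion_piB.
rewrite -[leLHS]/(completion_norm _) completion_normE.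
apply: limr_le; first exact: is_cvg_seminorm.
by exists N => // n /= Nn; exact: ue.
Qed.

Lemma completion_map_approx (x : completion) (e : R) :
  0 < e -> exists v, `|x - completion_map v| <= e.
Proof.
move=> e0; have [u ->] := completion_piP x.
have /asboolP/(_ e e0)[N uN] := cauchy_valP u.
exists (u N); apply: completion_pi_approx => n Nn.
exact/ltW/uN.
Qed.

Lemma completion_map_dense : dense (range completion_map).
Proof.
move=> O [x Ox] oO; have /nbhs_ballP[e /= e0 xeO] := open_nbhs_nbhs (conj oO Ox).
have [v xv] := completion_map_approx x (divr_gt0 e0 (ltr0Sn R 1)).
exists (completion_map v); split; last by exists v.
apply: xeO; rewrite -ball_normE /=; apply: le_lt_trans xv _.
by rewrite ltr_pdivrMr// ltr_pMr// ltr1n.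
Qed.

Lemma completion_complete (F : set_system completion) :
  ProperFilter F -> cauchy F -> cvg F.
Proof.
move=> FF Fc; pose d n : R := n.+1%:R^-1.
have d0 n : 0 < d n by rewrite invr_gt0.
have /choice[v vF] n : exists v, F (ball (completion_map v) (d n + d n)).
  have [x Fx] := (cauchyP F).1 Fc (d n) (d0 n).
  have [v xv] := completion_map_approx x (d0 n).
  exists v; apply: filterS Fx => y; rewrite -!ball_normE /= => xy.
  have -> : completion_map v - y = (completion_map v - x) + (x - y).
    by rewrite addrA subrK.
  by rewrite (le_lt_trans (ler_normD _ _))// ler_ltD// distrC.
have vd m n : p (v m - v n) < (d m + d m) + (d n + d n).
  have [y []] := filter_ex (filterI (vF m) (vF n)).
  rewrite -!ball_normE /= => my ny.
  rewrite -completion_map_norm raddfB /=.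
  have -> : completion_map (v m) - completion_map (v n)
          = (completion_map (v m) - y) + (y - completion_map (v n)).
    by rewrite addrA subrK.
  by rewrite (le_lt_trans (ler_normD _ _))// ltrD// distrC.
have d_small e : 0 < e -> exists N, forall n, (N <= n)%N -> d n < e.
  move=> e0; have /cvgr0Pnorm_lt/(_ e e0)[N _ hN] := @cvg_harmonic R.
  exists N => n /hN /=; apply: le_lt_trans; exact: ler_norm.
have vc : v \in cauchy_seqb.
  apply/asboolP => e e0; have [N dN] := d_small (e / 4) ltac:(by rewrite divr_gt0).
  exists N => m n /dN dm /dN dn; apply: lt_trans (vd m n) _; lra.
apply/cvg_ex; exists (completion_pi (CauchySpace vc)).
apply/cvgrPdist_lt => e e0.
have [N dN] := d_small (e / 8) ltac:(by rewrite divr_gt0).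
have dNe := dN N (leqnn N).
have vN : `|completion_pi (CauchySpace vc) - completion_map (v N)| <= e / 2.
  apply: completion_pi_approx => n /dN dn; apply/ltW/(lt_trans (vd n N)); lra.
apply: filterS (vF N) => y; rewrite -ball_normE /= => vy.
have -> : completion_pi (CauchySpace vc) - y
  = (completion_pi (CauchySpace vc) - completion_map (v N))
    + (completion_map (v N) - y) by rewrite addrA subrK.
apply: le_lt_trans (ler_normD _ _) _; lra.
Qed.

HB.instance Definition _ :=
  Uniform_isComplete.Build completion completion_complete.

End Completion.

(* Inclusions of normed spaces are rendered as linear isometric embeddings. *)
Record isom_embedding (R : realType) (E F : normedModType R) := IsomEmbedding {
  isom_embedding_map :> {linear E -> F} ;
  isom_embeddingE : forall x, `|isom_embedding_map x| = `|x| }.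

(* E(I): the coordinates along the formal variables x_i are given by a finitely
   supported function, x_i itself being [mkmalgU i 1]. *)
Definition formal_ext (R : realType) (E : normedModType R) (I : choiceType) :
  lmodType R := (E * malg I R)%type.

Definition formal_base (R : realType) (E : normedModType R) (I : choiceType)
  (b : E) : formal_ext E I := (b, 0).

Definition formal_var (R : realType) (E : normedModType R) (I : choiceType)
  (i : I) : formal_ext E I := (0, mkmalgU i 1).

Record types (R : realType) (E : normedModType R) (I : choiceType) := Types {
  type_seminorm :> seminorm (formal_ext E I) ;
  type_ext : forall b, type_seminorm (formal_base I b) = `|b| }.

Section Types.
Variables (R : realType) (E : normedModType R) (I : choiceType).

Lemma types_eqP (xi zeta : types E I) : xi =1 zeta -> xi = zeta.
Proof.
case: xi zeta => [[f fD fZ] fE] [[g gD gZ] gE] /= /funext fg.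
subst g; have ? := Prop_irrelevance fD gD; have ? := Prop_irrelevance fZ gZ.
by subst gD gZ; congr Types; exact: Prop_irrelevance.
Qed.

HB.instance Definition _ := gen_eqMixin (types E I).
HB.instance Definition _ := gen_choiceMixin (types E I).

Definition type_eval (xi : types E I) : {ptws formal_ext E I -> R} := xi.

HB.instance Definition _ :=
  Topological.copy (types E I) (initial_topology type_eval).

Lemma type_eval_continuous (x : formal_ext E I) :
  continuous (fun xi : types E I => xi x).
Proof.
move=> xi; apply: (@continuous_comp _ _ _ type_eval (fun f => f x)).
  exact: initial_continuous.
exact: (@proj_continuous _ (fun=> R : topologicalType) x).
Qed.

Variables (F : normedModType R) (j : isom_embedding E F) (a : I -> F).

Definition formal_eval (x : formal_ext E I) : F :=
  j x.1 + \sum_(i <- msupp x.2) mcoeff i x.2 *: a i.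

Lemma formal_evalEw (x : formal_ext E I) (d : {fset I}) :
  (msupp x.2 `<=` d)%fset ->
  formal_eval x = j x.1 + \sum_(i <- d) mcoeff i x.2 *: a i.
Proof.
move=> xd; congr (_ + _); apply: big_fset_incl => // i _ ix.
by rewrite mcoeff_outdom// scale0r.
Qed.

Lemma formal_eval_is_linear : linear formal_eval.
Proof.
move=> c x y.
pose d := (msupp x.2 `|` msupp y.2 `|` msupp (c *: x + y)%R.2)%fset.
rewrite (@formal_evalEw x d); last by rewrite /d -fsetUA fsubsetUl.
rewrite (@formal_evalEw y d); last first.
  by rewrite /d (fsetUC (msupp x.2)) -fsetUA fsubsetUl.
rewrite (@formal_evalEw (c *: x + y) d); last by rewrite /d fsubsetUr.
rewrite linearP scalerDr addrACA scaler_sumr -big_split /=; congr (_ + _).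
apply: eq_bigr => i _.
by rewrite mcoeffD mcoeffZ scalerDl scalerA.
Qed.

HB.instance Definition _ := GRing.isLinear.Build R (formal_ext E I) F _
  formal_eval formal_eval_is_linear.

Lemma tp_normD x y :
  `|formal_eval (x + y)| <= `|formal_eval x| + `|formal_eval y|.
Proof. by rewrite linearD ler_normD. Qed.

Lemma tp_normZ (c : R) x : `|formal_eval (c *: x)| = `|c| * `|formal_eval x|.
Proof. by rewrite linearZ normrZ. Qed.

Lemma tp_ext b : Seminorm tp_normD tp_normZ (formal_base I b) = `|b|.
Proof.
by rewrite /= /formal_eval /= msupp0 big_seq_fset0 addr0 isom_embeddingE.
Qed.

Definition tp : types E I := Types tp_ext.

End Types.

Section GeneratedSpace.
Variables (R : realType) (E : normedModType R) (I : choiceType).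
Variable xi : types E I.

Definition gen_space : completeNormedModType R := completion xi.

Definition gen_map : {linear formal_ext E I -> gen_space} :=
  @completion_map _ _ xi.

Definition gen_base (b : E) : gen_space := gen_map (formal_base I b).

Lemma gen_base_is_linear : linear gen_base.
Proof.
move=> c b b'; rewrite /gen_base -linearP; congr (gen_map _).
by apply/pair_equal_spec; split => //; rewrite /= scaler0 addr0.
Qed.

HB.instance Definition _ :=
  GRing.isLinear.Build R E gen_space _ gen_base gen_base_is_linear.

Lemma gen_base_norm b : `|gen_base b| = `|b|.
Proof. by rewrite [LHS]completion_map_norm type_ext. Qed.

Definition gen_incl : isom_embedding E gen_space :=
  @IsomEmbedding _ _ _ gen_base gen_base_norm.

Definition gen_var (i : I) : gen_space := gen_map (formal_var E i).

Lemma formal_extE (x : formal_ext E I) :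
  x = formal_base I x.1 + \sum_(i <- msupp x.2) mcoeff i x.2 *: formal_var E i.
Proof.
have pairP (y z : formal_ext E I) : y.1 = z.1 -> y.2 = z.2 -> y = z.
  by case: y z => [? ?] [? ?] /= -> ->.
apply: pairP.
  rewrite -[RHS]/(x.1 + (\sum_(i <- _) _).1) raddf_sum/= big1 ?addr0// => i _.
  by rewrite scaler0.
rewrite -[RHS]/(0 + (\sum_(i <- _) _).2) add0r raddf_sum /= [LHS]monalgE.
apply: eq_bigr => i _; apply/malgP => k.
by rewrite mcoeffZ !mcoeffU mulr_natr.
Qed.

Lemma tp_gen : tp gen_incl gen_var = xi.
Proof.
apply: types_eqP => x; rewrite -[RHS]completion_map_norm /=; congr `|_|.
rewrite [in RHS](formal_extE x) -[RHS]/(gen_map _) raddfD raddf_sum /=.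
by congr (_ + _); apply: eq_bigr => i _; rewrite linearZ.
Qed.

End GeneratedSpace.

Section Distance.
Variables (R : realType) (E : completeNormedModType R) (n : nat).

Definition type_dist (xi zeta : types E 'I_n) : R :=
  inf [set r | exists (F : completeNormedModType R) (j : isom_embedding E F)
                 (a b : 'I_n -> F),
       [/\ tp j a = xi, tp j b = zeta &
           r = \big[Num.max/0]_(i < n) `|a i - b i| ] ].

Definition metrically_open (X : set (types E 'I_n)) : Prop :=
  forall xi, X xi -> exists2 e : R, 0 < e &
    forall zeta, type_dist xi zeta < e -> X zeta.

End Distance.

Section Category.
Variable T : topologicalType.

Definition nowhere_dense (A : set T) : Prop := (closure A)° = set0.

Definition meagre (A : set T) : Prop :=
  exists F : nat -> set T,
    (forall k, nowhere_dense (F k)) /\ A = \bigcup_k F k.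

Definition comeagre (A : set T) : Prop := meagre (~` A).

Definition separable : Prop := exists2 A : set T, countable A & dense A.

End Category.

Section Gurarij.
Variable R : realType.

Definition finite_dim (E : normedModType R) : Prop :=
  exists (n : nat) (b : 'I_n -> E),
    forall x, exists c : 'I_n -> R, x = \sum_(i < n) c i *: b i.

Definition gurarij (G : completeNormedModType R) : Prop :=
  forall (e : R) (E F : completeNormedModType R)
    (i : isom_embedding E F) (phi : isom_embedding E G),
  0 < e -> finite_dim E -> finite_dim F ->
  exists psi : {linear F -> G},
    (forall x, psi (i x) = phi x) /\
    (forall x, (1 - e) * `|x| <= `|psi x| <= (1 + e) * `|x|).

Definition gurarij_type (E : completeNormedModType R) (xi : types E nat) : Prop :=
  gurarij (gen_space xi).

Definition omits (E G : completeNormedModType R) (j : isom_embedding E G)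
  (n : nat) (X : set (types E 'I_n)) : Prop :=
  forall a : 'I_n -> G, ~ X (tp j a).

End Gurarij.

(* Main.v *)
Require Import Defs.
From HB Require Import structures.
From mathcomp Require Import all_boot all_order all_algebra finmap.
From mathcomp Require Import all_classical all_reals all_analysis.
From mathcomp Require Import lra.
From mathcomp Require monalg.
Import -(notations) monalg.
Import Order.TTheory GRing.Theory Num.Theory.
Import numFieldNormedType.Exports.

(** The type space [types E nat] is a Baire space, so it suffices to write the
    types that fail the conclusion as a countable union of nowhere dense sets.
    Write [a i] for the realisations [gen_var xi i] of the variables in
    [gen_space xi].  There are three kinds of exceptional types.

    - [covers_base] fails: some vector of a countable dense subset of [E] is not
      within a given [1 / (m + 1)] of any [a i].
    - [rich] fails.  Richness is a coded homogeneity property: if the tuple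
      [a \o s] has an extension by finitely many vectors, described up to finite
      precision by integer data [w], then some variables realize this
      description.  There are countably many data [s], [w].
    - a tuple of distinct variables realizes a type in one of the nowhere dense
      sets that cover [X n].

    The first two sets are contained in boundaries of open sets
    ([nowhere_dense_boundary]): a neighbourhood of [xi] only constrains finitely
    many variables, so the unused ones may be interpreted as the missing vectors
    after an amalgamation ([extension_realized_dense]).  The third is the
    preimage of a nowhere dense set under restriction to finitely many variables,
    a map that is continuous and open; its openness ([lift_near]) comes from
    amalgamating along maps that are only approximately isometric
    ([amalgamation]).  Along a finite family of parameters, pointwise closeness
    of two types at finitely many vectors suffices for this ([grid_close]).

    For a type outside the exceptional sets, richness and density of the [a i]
    give, for every finite tuple of [gen_space xi] and every abstract
    finite-dimensional extension of it, distinct variables realizing the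
    extension up to any error ([rich_extension]).  Hence the [a i] are dense, any
    tuple is close to a tuple of distinct variables -- so that a metrically open
    set of types realized anywhere is realized by distinct variables and
    [gen_space xi] omits [X n] ([rich_omits]) -- and finite-dimensional extensions
    embed almost isometrically ([rich_gurarij]).

    The Baire property ([types_baire]) holds because sequences of types that
    are bounded on every variable converge pointwise along an ultrafilter. *)

Set Implicit Arguments.
Unset Strict Implicit.
Unset Printing Implicit Defensive.

Local Open Scope classical_set_scope.
Local Open Scope ring_scope.

(** * Gluing semi-norms *)

Section Pullback.
Variables (R : realType) (V W : lmodType R).
Variables (p : seminorm V) (f : {linear W -> V}).

Lemma pullbackD x y : p (f (x + y)) <= p (f x) + p (f y).
Proof. by rewrite linearD seminormD. Qed.

Lemma pullbackZ (a : R) x : p (f (a *: x)) = `|a| * p (f x).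
Proof. by rewrite linearZ seminormZ. Qed.

Definition pullback : seminorm W := Seminorm pullbackD pullbackZ.

End Pullback.

Definition norm_seminorm (R : realType) (G : normedModType R) : seminorm G :=
  Seminorm (@ler_normD _ G) (@normrZ _ G).

Section Glue.
Variables (R : realType) (V W T : lmodType R).
Variables (q : seminorm V) (p : seminorm W) (c : seminorm T).
Variables (al : {linear T -> V}) (be : {linear T -> W}).

Let cost (x : V * W) t := q (x.1 + al t) + p (x.2 - be t) + c t.

Let cost_ge0 x t : 0 <= cost x t.
Proof. by rewrite !addr_ge0 ?seminorm_ge0. Qed.

Definition glue_fun (x : V * W) : R := inf (range (cost x)).

Let glue_le x t : glue_fun x <= cost x t.
Proof.
apply: ge_inf; last by exists t.
by exists 0 => _ [s _ <-]; exact: cost_ge0.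
Qed.

Let le_glue x y : (forall t, y <= cost x t) -> y <= glue_fun x.
Proof.
move=> yx; apply: lb_le_inf; first by exists (cost x 0), 0.
by move=> _ [t _ <-].
Qed.

Lemma glueD x y : glue_fun (x + y) <= glue_fun x + glue_fun y.
Proof.
rewrite -lerBlDr; apply: le_glue => t.
rewrite lerBlDr [leRHS]addrC -lerBlDr.
apply: le_glue => s; rewrite lerBlDr.
apply: le_trans (glue_le _ (t + s)) _; rewrite /cost /= !linearD /=.
rewrite [X in q X]addrACA [X in p X]addrACA.
have := seminormD q (x.1 + al t) (y.1 + al s).
have := seminormD p (x.2 - be t) (y.2 - be s).
have := seminormD c t s; lra.
Qed.

Let glueZ_le (a : R) x : glue_fun (a *: x) <= `|a| * glue_fun x.
Proof.
have [->|a0] := eqVneq a 0.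
  rewrite normr0 mul0r (le_trans (glue_le _ 0))// /cost /= !scale0r !linear0.
  by rewrite !addr0 !seminorm0 !addr0.
rewrite mulrC -ler_pdivrMr ?normr_gt0//; apply: le_glue => t.
rewrite ler_pdivrMr ?normr_gt0// (le_trans (glue_le _ (a *: t)))//.
rewrite /cost /= !linearZ /= -!scalerDr !seminormZ -!mulrDr.
by rewrite mulrC.
Qed.

Lemma glueZ (a : R) x : glue_fun (a *: x) = `|a| * glue_fun x.
Proof.
apply/eqP; rewrite eq_le glueZ_le /=.
have [->|a0] := eqVneq a 0.
  by rewrite normr0 mul0r; apply: le_glue.
rewrite mulrC -ler_pdivlMr ?normr_gt0//.
have := glueZ_le a^-1 (a *: x).
by rewrite scalerA mulVf// scale1r normfV mulrC.
Qed.

(** The largest semi-norm on [V * W] bounded by [q] on [V], by [p] on [W] and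
    by [c t] on the difference of the two copies [al t] and [be t]. *)
Definition glue : seminorm (V * W)%type := Seminorm glueD glueZ.

Hypothesis close : forall t, `|q (al t) - p (be t)| <= c t.

Lemma glue_left v : glue (v, 0) = q v.
Proof.
apply/eqP; rewrite eq_le; apply/andP; split.
  apply: le_trans (glue_le _ 0) _; rewrite /cost /= !linear0 !addr0.
  by rewrite !seminorm0 !addr0.
apply: le_glue => t; rewrite /cost /= sub0r seminormN.
have := seminormD q (v + al t) (- al t); rewrite addrK seminormN.
by have := close t; rewrite ler_norml => /andP[]; lra.
Qed.

Lemma glue_right w : glue (0, w) = p w.
Proof.
apply/eqP; rewrite eq_le; apply/andP; split.
  apply: le_trans (glue_le _ 0) _; rewrite /cost /= !linear0 !addr0.
  by rewrite !seminorm0 addr0 add0r.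
apply: le_glue => t; rewrite /cost /= add0r.
have := seminormD p (w - be t) (be t); rewrite subrK.
by have := close t; rewrite ler_norml => /andP[]; lra.
Qed.

Lemma glue_close t : glue (al t, - be t) <= c t.
Proof.
apply: le_trans (glue_le _ (- t)) _; rewrite /cost /= !linearN /= subrr.
by rewrite opprK addNr !seminorm0 !add0r seminormN.
Qed.

End Glue.

(** Approximate amalgamation.  If the copies [al] and [be] of a parameter space
    [T] in [G] and in [W] have norms that differ by at most [c], then [G] and
    [W] embed in one Banach space where the copies are [c]-close.  With
    [c = 0] this is the usual amalgamation over a common subspace. *)
Lemma amalgamation (R : realType) (G : normedModType R) (W T : lmodType R)
    (p : seminorm W) (c : seminorm T) (al : {linear T -> G})
    (be : {linear T -> W}) :
  (forall t, `| `|al t| - p (be t)| <= c t) ->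
  exists (F : completeNormedModType R) (J : isom_embedding G F)
         (Phi : {linear W -> F}),
    (forall w, `|Phi w| = p w) /\ forall t, `|J (al t) - Phi (be t)| <= c t.
Proof.
move=> close0.
have close t : `|norm_seminorm G (al t) - p (be t)| <= c t := close0 t.
pose r := glue (norm_seminorm G) p c al be.
pose Jf (g : G) := completion_map r (g, 0).
have Jl : linear Jf.
  move=> a x y; rewrite /Jf -linearP; congr completion_map.
  by apply/pair_equal_spec; split => //=; rewrite scaler0 addr0.
pose Pf (w : W) := completion_map r (0, w).
have Pl : linear Pf.
  move=> a x y; rewrite /Pf -linearP; congr completion_map.
  by apply/pair_equal_spec; split => //=; rewrite scaler0 addr0.
pose JL : {linear G -> completion r} := HB.pack Jf (GRing.isLinear.Build _ _ _ _ Jf Jl).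
pose PL : {linear W -> completion r} := HB.pack Pf (GRing.isLinear.Build _ _ _ _ Pf Pl).
have JE x : `|JL x| = `|x|.
  by rewrite [LHS]completion_map_norm /r (glue_left close).
exists (completion r), (IsomEmbedding JE), PL; split=> [w|t].
  by rewrite [LHS]completion_map_norm /r (glue_right close).
rewrite /= /Jf /Pf -linearB completion_map_norm.
rewrite (_ : (al t, 0) - (0, be t) = (al t, - be t)); first exact: glue_close.
by apply/pair_equal_spec; split => /=; rewrite ?subr0 ?sub0r.
Qed.

(** * Semi-norms on coefficient spaces *)

Section Combination.
Variables (R : realType) (I : finType).

Definition combination (V : lmodType R) (b : I -> V) (t : I -> R) : V :=
  \sum_i t i *: b i.

Lemma combination_is_linear (V : lmodType R) (b : I -> V) :
  linear (combination b).
Proof.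
move=> a s t; rewrite /combination scaler_sumr -big_split /=.
by apply: eq_bigr => i _; rewrite !fctE scalerDl scalerA.
Qed.

HB.instance Definition _ (V : lmodType R) (b : I -> V) :=
  GRing.isLinear.Build R (I -> R) V _ (combination b)
    (combination_is_linear b).

Definition unit_coef (i : I) : I -> R := fun j => (j == i)%:R.

Lemma combination_unit (V : lmodType R) (b : I -> V) i :
  combination b (unit_coef i) = b i.
Proof.
rewrite /combination (bigD1 i)//= /unit_coef eqxx scale1r big1 ?addr0// => j.
by move=> /negbTE ->; rewrite scale0r.
Qed.

Lemma combination_coef (t : I -> R) : combination unit_coef t = t.
Proof.
apply/funext => i; rewrite /combination fct_sumE (bigD1 i)//= big1 ?addr0.
  by rewrite fctE /unit_coef eqxx /GRing.scale /= mulr1.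
move=> j /negbTE ji.
by rewrite fctE /unit_coef eq_sym ji /GRing.scale /= mulr0.
Qed.

Lemma linear_combination (V W : lmodType R) (f : {linear V -> W}) (b : I -> V)
    t :
  f (combination b t) = combination (f \o b) t.
Proof. by rewrite linear_sum; apply: eq_bigr => i _; rewrite linearZ. Qed.

Lemma eq_combination (V : lmodType R) (b b' : I -> V) t :
  b =1 b' -> combination b t = combination b' t.
Proof. by move=> bb; apply: eq_bigr => i _; rewrite bb. Qed.

Definition l1_norm (t : I -> R) : R := \sum_i `|t i|.

Lemma l1_normD s t : l1_norm (s + t) <= l1_norm s + l1_norm t.
Proof. by rewrite -big_split; apply: ler_sum => i _; exact: ler_normD. Qed.

Lemma l1_normZ (a : R) t : l1_norm (a *: t) = `|a| * l1_norm t.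
Proof. by rewrite mulr_sumr; apply: eq_bigr => i _; rewrite normrM. Qed.

Definition l1 : seminorm (I -> R) := Seminorm l1_normD l1_normZ.

Lemma ler_l1 (t : I -> R) i : `|t i| <= l1 t.
Proof. by rewrite /= /l1_norm (bigD1 i)//= lerDl sumr_ge0. Qed.

Lemma l1_unit i : l1 (unit_coef i) = 1.
Proof.
rewrite /= /l1_norm (bigD1 i)//= /unit_coef eqxx normr1 big1 ?addr0// => j.
by move=> /negbTE ->; rewrite normr0.
Qed.

Lemma l1_eq0 (t : I -> R) : l1 t = 0 -> t = 0.
Proof.
move=> t0; apply/funext => i; apply/eqP; rewrite -normr_le0 -t0.
exact: ler_l1.
Qed.

Lemma seminorm_sum (V : lmodType R) (p : seminorm V) (F : I -> V) :
  p (\sum_i F i) <= \sum_i p (F i).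
Proof.
elim/big_rec2 : _ => [|i y x _ xy]; first by rewrite seminorm0.
exact: le_trans (seminormD _ _ _) (lerD _ _).
Qed.

Lemma seminorm_combination (V : lmodType R) (p : seminorm V) (b : I -> V) t
    (e : R) :
  (forall i, p (b i) <= e) -> p (combination b t) <= e * l1 t.
Proof.
move=> be; rewrite mulr_sumr /combination.
apply: le_trans (seminorm_sum _ _) _; apply: ler_sum => i _.
by rewrite seminormZ mulrC ler_wpM2r.
Qed.

Lemma combination_dist (V : lmodType R) (p : seminorm V) (b b' : I -> V) t
    (e : R) :
  (forall i, p (b i - b' i) <= e) ->
  p (combination b t - combination b' t) <= e * l1 t.
Proof.
move=> be; have -> : combination b t - combination b' t
    = combination (fun i => b i - b' i) t; last exact: seminorm_combination.
by rewrite /combination -sumrB; apply: eq_bigr => i _; rewrite scalerBr.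
Qed.

Lemma seminorm_le_unit (p : seminorm (I -> R)) t (e : R) :
  (forall i, `|t i| <= e) -> p t <= (\sum_i p (unit_coef i)) * e.
Proof.
move=> te; rewrite -{1}(combination_coef t) /combination.
rewrite mulr_suml; apply: le_trans (seminorm_sum _ _) _.
apply: ler_sum => i _.
by rewrite seminormZ mulrC ler_wpM2l ?seminorm_ge0.
Qed.

End Combination.

Arguments l1 {R I}.
Arguments unit_coef {R I}.

(** * A countable net of semi-norms *)

Section Grid.
Variables (R : realType) (I : finType) (K : nat).

Definition grid_index := {ffun I -> 'I_K.*2.+1}.

Definition grid_vec (g : grid_index) : I -> R :=
  fun i => (g i : nat)%:R - K%:R.

Lemma grid_round (x : R) : `|x| <= K%:R ->
  exists g : 'I_K.*2.+1, `|x - ((g : nat)%:R - K%:R)| <= 1.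
Proof.
rewrite ler_norml => /andP[xK Kx].
have x0 : 0 <= x + K%:R by lra.
have gK : (Num.truncn (x + K%:R) < K.*2.+1)%N.
  rewrite ltnS -(ler_nat R); apply: le_trans (_ : x + K%:R <= _).
    by rewrite truncn_le.
  by rewrite -addnn natrD; lra.
exists (Ordinal gK) => /=.
have /andP[h1 h2] := truncn_itv x0.
by rewrite ler_norml; apply/andP; split; move: h2; rewrite -natr1; lra.
Qed.

Lemma grid_vec_near (t : I -> R) : (forall i, `|t i| <= K%:R) ->
  exists g, forall i, `|(t - grid_vec g) i| <= 1.
Proof.
move=> tK; have /choice[g gP] i := grid_round (tK i).
by exists (finfun g) => i; rewrite !fctE /grid_vec ffunE.
Qed.

Definition grid_error (p : seminorm (I -> R)) : R :=
  2 * (\sum_i p (unit_coef i)) + 2 * #|I|%:R + 2.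

Lemma grid_error_gt0 (p : seminorm (I -> R)) : 0 < grid_error p.
Proof.
rewrite /grid_error ltr_wpDl// addr_ge0// mulr_ge0//.
by apply: sumr_ge0 => i _; exact: seminorm_ge0.
Qed.

Hypothesis K0 : (0 < K)%N.

(** Vectors of the box [-K, K] are within distance [1] of an integer point, and
    [p], [q] are Lipschitz, so they differ on the whole box by a constant that
    does not depend on [K].  By homogeneity the unit box sees this constant
    divided by [K]. *)
Lemma grid_close (p q : seminorm (I -> R)) :
  (forall g, `|p (grid_vec g) - q (grid_vec g)| <= 2) ->
  forall t, `|p t - q t| <= grid_error p / K%:R * l1 t.
Proof.
move=> pq t.
have K0R : 0 < K%:R :> R by rewrite ltr0n.
have unitE i : exists g, grid_vec g = K%:R *: unit_coef i.
  have /choice[g gP] j : exists m : 'I_K.*2.+1,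
      m = (if j == i then K.*2 else K) :> nat.
    have h : ((if j == i then K.*2 else K) < K.*2.+1)%N.
      by case: ifP; rewrite ltnS// -addnn leq_addr.
    by exists (Ordinal h).
  exists (finfun g); apply/funext => j; rewrite /grid_vec ffunE gP !fctE.
  rewrite /unit_coef /GRing.scale /=; case: eqP => _.
    by rewrite -addnn natrD addrK mulr1.
  by rewrite subrr mulr0.
(* [K *: unit_coef i] is a grid point, so [q] inherits a Lipschitz bound. *)
have q_unit i : q (unit_coef i) <= p (unit_coef i) + 2.
  have [g gE] := unitE i; have := pq g; rewrite gE !seminormZ.
  rewrite -mulrBr normrM normr_id (ger0_norm (ltW K0R)).
  have : 1 <= K%:R :> R by rewrite ler1n.
  move: (p _) (q _) => a b K1 h; rewrite -lerBlDl.
  apply: le_trans (ler_norm _) _; rewrite distrC; apply: le_trans h.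
  by rewrite ler_peMl.
have sum_q : \sum_i q (unit_coef i) <= \sum_i p (unit_coef i) + 2 * #|I|%:R.
  rewrite mulr_natr -sumr_const -big_split /=.
  by apply: ler_sum => i _; exact: q_unit.
have box s : (forall i, `|s i| <= K%:R) -> `|p s - q s| <= grid_error p.
  move=> /grid_vec_near[g gP].
  have hp := le_trans (seminorm_dist p s (grid_vec g)) (seminorm_le_unit p gP).
  have hq := le_trans (seminorm_dist q s (grid_vec g)) (seminorm_le_unit q gP).
  move: hp hq (pq g) sum_q; rewrite /grid_error !mulr1 !ler_norml.
  by move=> /andP[? ?] /andP[? ?] /andP[? ?] ?; apply/andP; split; lra.
have [t0|t0] := eqVneq (l1 t) 0.
  by rewrite (l1_eq0 t0) !seminorm0 subrr normr0 mulr0.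
have tpos : 0 < l1 t by rewrite lt_def t0 seminorm_ge0.
have a0 : 0 <= K%:R / l1 t by rewrite divr_ge0 ?ltW.
have h : K%:R / l1 t * `|p t - q t| <= grid_error p.
  have := box ((K%:R / l1 t) *: t).
  rewrite !seminormZ (ger0_norm a0) -mulrBr normrM (ger0_norm a0); apply => i.
  rewrite !fctE normrM (ger0_norm a0).
  by rewrite -mulrA ger_pMr// mulrC ler_pdivrMr// mul1r ler_l1.
rewrite mulrAC ler_pdivlMr// mulrC.
by move: h; rewrite mulrAC ler_pdivrMr.
Qed.

(** Semi-norms with the same integer data [w] are close by [grid_close], and
    there are countably many [w]: this is separability of the space of
    semi-norms, in a form without limits. *)
Definition coarse (w : {ffun grid_index -> nat}) (p : seminorm (I -> R)) :=
  forall g, `|p (grid_vec g) - (w g)%:R| < 1.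

Lemma coarse_exists p : exists w, coarse w p.
Proof.
exists [ffun g => Num.truncn (p (grid_vec g))] => g; rewrite ffunE.
have /andP[h1 h2] := truncn_itv (seminorm_ge0 p (grid_vec g)).
by rewrite ltr_norml; apply/andP; split; move: h2; rewrite -natr1; lra.
Qed.

Lemma coarse_close w p q : coarse w p -> coarse w q ->
  forall t, `|p t - q t| <= grid_error p / K%:R * l1 t.
Proof.
move=> wp wq; apply: grid_close => g.
move: (wp g) (wq g); rewrite !ltr_norml ler_norml.
by move=> /andP[? ?] /andP[? ?]; apply/andP; split; lra.
Qed.

End Grid.

Lemma grid_size_exists (R : realType) (I : finType) (p : seminorm (I -> R))
    (e : R) : 0 < e -> exists2 K, (0 < K)%N & grid_error p / K%:R <= e.
Proof.
move=> e0; have ep : 0 <= grid_error p / e by rewrite divr_ge0 ?ltW ?grid_error_gt0.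
exists (Num.truncn (grid_error p / e)).+1 => //.
have /andP[_ h] := truncn_itv ep.
by rewrite ler_pdivrMr ?ltr0n// -ler_pdivrMl// mulrC ltW.
Qed.

(** * Nowhere dense and meagre sets *)

Section Category.
Variable T : topologicalType.

Lemma nowhere_dense_sub (A B : set T) :
  A `<=` B -> nowhere_dense B -> nowhere_dense A.
Proof.
move=> AB B0; apply/seteqP; split => // x; rewrite -B0.
exact/interiorS/closure_subset.
Qed.

(** The boundary of an open set contains no nonempty open set; the
    exceptional sets of types below are shown to be nowhere dense in this way. *)
Lemma nowhere_dense_boundary (A U : set T) :
  open U -> A `<=` closure U -> A `<=` ~` U -> nowhere_dense A.
Proof.
move=> oU AU AnU; apply/seteqP; split => // x xA.
have [y [Ay Iy]] := interior_subset xA _ (open_nbhs_nbhs (conj (@open_interior _ _) xA)).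
have [z [Uz Iz]] := AU y Ay _ (open_nbhs_nbhs (conj (@open_interior _ _) Iy)).
have [t [At Ut]] := interior_subset Iz _ (open_nbhs_nbhs (conj oU Uz)).
exact: AnU At Ut.
Qed.

Lemma nowhere_dense_closure (A W : set T) x :
  nowhere_dense A -> nbhs (x : T) W -> exists2 y, W° y & ~ closure A y.
Proof.
move=> A0 Wx; apply: contrapT => /forall2NP h.
have : (closure A)° x; last by rewrite A0.
apply: filterS (open_nbhs_nbhs (conj (@open_interior _ W) Wx)) => y Wy.
by have [//|/contrapT] := h y.
Qed.

Lemma meagre_cover (I : countType) (F : I -> set T) (A : set T) :
  (forall i, nowhere_dense (F i)) -> A `<=` \bigcup_i F i -> meagre A.
Proof.
move=> F0 AF.
exists (fun k => if choice.unpickle k is Some i then A `&` F i else set0); split.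
  move=> k; case: choice.unpickle => [i|]; first exact: nowhere_dense_sub (F0 i).
  by rewrite /nowhere_dense closure0 interior0.
apply/seteqP; split => [x Ax|x [k _]].
  have [i _ Fx] := AF x Ax; exists (choice.pickle i) => //.
  by rewrite choice.pickleK; split.
by case: choice.unpickle => // i [].
Qed.

End Category.

(** * Types *)

Section IsomComp.
Variables (R : realType) (E F G : normedModType R).
Variables (f : isom_embedding E F) (g : isom_embedding F G).

Lemma isom_comp_norm x : `|(g \o f) x| = `|x|.
Proof. by rewrite /= !isom_embeddingE. Qed.

Definition isom_comp : isom_embedding E G :=
  @IsomEmbedding R E G (g \o f : {linear E -> G}) isom_comp_norm.

End IsomComp.

Section TypeTheory.
Variables (R : realType) (E : normedModType R) (I : choiceType).
Implicit Types (xi zeta : types E I) (x y : formal_ext E I).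

Definition basic_nbhd xi (ys : seq (formal_ext E I)) (e : R) :
  set (types E I) := [set zeta | forall y, y \in ys -> `|zeta y - xi y| <= e].

Lemma basic_nbhd_nbhs xi ys (e : R) : 0 < e -> nbhs xi (basic_nbhd xi ys e).
Proof.
move=> e0; elim: ys => [|y ys IH]; first by apply: filterS filterT.
have hy := @type_eval_continuous _ _ _ y xi.
move/cvgrPdist_le : hy => /(_ e e0) hy.
apply: filterS2 hy IH => zeta h1 h2 z; rewrite in_cons => /orP[/eqP ->|/h2//].
by rewrite distrC.
Qed.

(** The sets [basic_nbhd] form a filter that converges pointwise, hence in the
    product topology from which the topology of types is induced. *)
Lemma nbhs_basic xi W : nbhs xi W ->
  exists ys, exists2 e : R, 0 < e & basic_nbhd xi ys e `<=` W.
Proof.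
pose F : set_system (types E I) :=
  [set A | exists ys, exists2 e : R, 0 < e & basic_nbhd xi ys e `<=` A].
have FF : Filter F.
  split.
  - by exists [::], 1.
  - move=> A B [s [d d0 dA]] [t [e e0 eB]]; exists (s ++ t), (Num.min d e).
      by rewrite lt_min d0.
    move=> zeta h; split.
      apply: dA => y ys; have := h y; rewrite mem_cat ys => /(_ isT).
      by rewrite le_min => /andP[].
    apply: eB => y yt; have := h y; rewrite mem_cat yt orbT => /(_ isT).
    by rewrite le_min => /andP[].
  - by move=> A B AB [s [d d0 dA]]; exists s, d => // z /dA /AB.
have : @type_eval R E I @ F --> type_eval xi.
  apply/cvg_sup => y.
  have ev_surj : (fun f : formal_ext E I -> R => f y) @` setT = setT.
    by apply/seteqP; split => // r _; exists (cst r).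
  apply/cvg_image => // B /nbhs_ballP[e /= e0 eB].
  exists ((fun f : formal_ext E I -> R => f y) @^-1` B); last first.
    exact: image_preimage.
  exists [:: y], (e / 2); first by rewrite divr_gt0.
  move=> zeta /(_ y); rewrite mem_seq1 eqxx => /(_ isT) h; apply: eB.
  rewrite -ball_normE /= distrC; apply: le_lt_trans h _.
  by rewrite ltr_pdivrMr// ltr_pMr// ltr1n.
move=> Fxi [_ [[B Bo <-] Bxi] BW].
have : F (@type_eval R E I @^-1` B) by apply: Fxi; exact: open_nbhs_nbhs.
by apply: filterS => z /BW.
Qed.

Lemma gen_map_norm xi x : `|gen_map xi x| = xi x.
Proof. exact: completion_map_norm. Qed.

Variables (F : normedModType R) (j : isom_embedding E F) (a : I -> F).

Lemma formal_eval_base b : formal_eval j a (formal_base I b) = j b.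
Proof. by rewrite /formal_eval /= msupp0 big_seq_fset0 addr0. Qed.

Lemma formal_eval_var i : formal_eval j a (formal_var E i) = a i.
Proof.
rewrite (@formal_evalEw _ _ _ _ _ _ _ [fset i]%fset); last first.
  by rewrite /= msuppU; case: ifP.
by rewrite big_seq_fset1 /= linear0 add0r mcoeffU eqxx scale1r.
Qed.

Lemma formal_eval_gen (xi : types E I) x :
  formal_eval (gen_incl xi) (gen_var xi) x = gen_map xi x.
Proof.
rewrite [in RHS](formal_extE x) linearD linear_sum; congr (_ + _).
by apply: eq_bigr => i _; rewrite linearZ.
Qed.

Lemma tpE x : tp j a x = `|formal_eval j a x|.
Proof. by []. Qed.

End TypeTheory.

Section Subtuple.
Variables (R : realType) (E : normedModType R) (I : choiceType).
Variable s : I -> nat.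

Definition subtuple (xi : types E nat) : types E I :=
  tp (gen_incl xi) (gen_var xi \o s).

Definition rename (x : formal_ext E I) : formal_ext E nat :=
  formal_base nat x.1 + \sum_(i <- msupp x.2) mcoeff i x.2 *: formal_var E (s i).

Lemma subtupleE xi x : subtuple xi x = xi (rename x).
Proof.
rewrite tpE -gen_map_norm /rename linearD linear_sum; congr (`|_ + _|).
by apply: eq_bigr => i _; rewrite linearZ.
Qed.

Lemma subtuple_tp (F : normedModType R) (j : isom_embedding E F)
    (a : nat -> F) : subtuple (tp j a) = tp j (a \o s).
Proof.
apply: types_eqP => x; rewrite subtupleE !tpE /rename linearD linear_sum /=.
rewrite formal_eval_base; congr (`|_ + _|).
by apply: eq_bigr => i _; rewrite linearZ /= formal_eval_var.
Qed.

Lemma subtuple_continuous : continuous subtuple.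
Proof.
move=> xi W /nbhs_basic[ys [e e0 eW]].
apply: filterS (basic_nbhd_nbhs xi (map rename ys) e0) => zeta h.
by apply: eW => y yys; rewrite !subtupleE; apply/h/map_f.
Qed.

End Subtuple.

Lemma tp_agree (R : realType) (E : normedModType R) (I : choiceType)
    (F : normedModType R) (j : isom_embedding E F) (a b : I -> F)
    (y : formal_ext E I) :
  (forall i, i \in msupp y.2 -> a i = b i) -> tp j a y = tp j b y.
Proof.
move=> ab; rewrite !tpE /formal_eval; congr (`|_ + _|).
by apply: eq_big_seq => i /ab ->.
Qed.

Lemma tp_isom (R : realType) (E F G : normedModType R) (I : choiceType)
    (j : isom_embedding E F) (g : isom_embedding F G) (a : I -> F)
    (y : formal_ext E I) :
  tp (isom_comp j g) (g \o a) y = tp j a y.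
Proof.
rewrite !tpE -[RHS](isom_embeddingE g) /formal_eval linearD linear_sum.
by congr (`|_ + _|); apply: eq_bigr => i _; rewrite linearZ.
Qed.

(** * Extending types *)

Section TupleNorm.
Variables (R : realType) (I : finType).

Definition zero_seminorm (V : lmodType R) : seminorm V.
Proof.
by exists (fun=> 0) => *; rewrite ?addr0 ?mulr0.
Defined.

Definition tuple_norm (G : normedModType R) (b : I -> G) : seminorm (I -> R) :=
  pullback (norm_seminorm G) (combination b).

Lemma tuple_normE (G : normedModType R) (b : I -> G) t :
  tuple_norm b t = `|combination b t|.
Proof. by []. Qed.

End TupleNorm.

Definition case_sum (I J T : Type) (a : I -> T) (b : J -> T) (x : I + J) : T :=
  match x with inl i => a i | inr j => b j end.

Section Extension.
Variables (R : realType) (I J : finType).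

(** [p] stands for the norm on a tuple that continues [g] by [J] further vectors
    in some extension of [G]. *)
Definition extends_tuple (G : normedModType R) (g : I -> G)
    (p : seminorm (I + J -> R)) : Prop :=
  forall t : I -> R,
    p (combination (unit_coef \o inl) t) = `|combination g t|.

Lemma extends_tuple_norm (G B : normedModType R) (g : I -> G)
    (b : I + J -> B) :
  (forall t, `|combination g t| = `|combination (b \o inl) t|) ->
  extends_tuple g (tuple_norm b).
Proof.
move=> gb t; rewrite gb tuple_normE linear_combination; congr `|_|.
by apply: eq_combination => i; rewrite /= combination_unit.
Qed.

(** Such an extension exists: amalgamate [G] with the coefficient space normed by
    [p] over the span of [g]. *)
Lemma extends_realized (G : normedModType R) (g : I -> G)
    (p : seminorm (I + J -> R)) : extends_tuple g p ->
  exists (F : completeNormedModType R) (j : isom_embedding G F) (f : J -> F),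
    forall u, tuple_norm (case_sum (j \o g) f) u = p u.
Proof.
move=> gp.
have close t : `| `|combination g t|
    - p (combination (unit_coef \o inl) t)| <= zero_seminorm (I -> R) t.
  by rewrite gp subrr normr0.
have [F [j [Phi [PhiE jPhi]]]] := amalgamation close.
exists F, j, (fun i => Phi (unit_coef (inr i))) => u.
rewrite -(PhiE u) -[in RHS](combination_coef u) linear_combination.
rewrite tuple_normE; congr `|_|; apply: eq_combination => -[i|//] /=.
have := jPhi (unit_coef i); rewrite /= !combination_unit normr_le0 subr_eq0.
by move/eqP.
Qed.

End Extension.

Section Variables.
Variables (R : realType) (E : normedModType R).
Implicit Types xi : types E nat.

Definition var_norm (I : finType) xi (s : I -> nat) : seminorm (I -> R) :=
  tuple_norm (gen_var xi \o s).

Lemma var_normE (I : finType) xi (s : I -> nat) t :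
  var_norm xi s t = xi (combination (@formal_var R E nat \o s) t).
Proof. by rewrite -gen_map_norm linear_combination. Qed.

Lemma var_norm_tp (I : finType) (F : normedModType R)
    (j : isom_embedding E F) (a : nat -> F) (s : I -> nat) t :
  var_norm (tp j a) s t = tuple_norm (a \o s) t.
Proof.
rewrite var_normE tpE linear_combination tuple_normE; congr `|_|.
by apply: eq_combination => i; rewrite /= formal_eval_var.
Qed.

(** A neighbourhood of [xi] constrains finitely many variables: the others may
    be sent anywhere, even outside [gen_space xi]. *)
Lemma nbhs_free_variables xi W : nbhs xi W ->
  exists N, forall (F : normedModType R) (j : isom_embedding (gen_space xi) F)
    (a : nat -> F), (forall n, (n < N)%N -> a n = j (gen_var xi n)) ->
    W (tp (isom_comp (gen_incl xi) j) a).
Proof.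
move=> /nbhs_basic[ys [e e0 eW]].
have [N NP] : exists N, forall y, y \in ys -> forall n, n \in msupp y.2 ->
    (n < N)%N.
  elim: ys {eW} => [|y ys [N NP]]; first by exists 0%N.
  exists (maxn N (\max_(n <- msupp y.2) n).+1) => z.
  rewrite in_cons => /orP[/eqP ->|/NP h] n ny; rewrite leq_max; last by rewrite h.
  by rewrite [X in _ || X]ltnS (@leq_bigmax_seq _ _ xpredT id) ?orbT.
exists N => F j a aj; apply: eW => y yys.
rewrite (@tp_agree _ _ _ _ _ a (j \o gen_var xi)); last first.
  by move=> n /(NP y yys) /aj.
by rewrite tp_isom tp_gen subrr normr0 ltW.
Qed.

Lemma open_type_lt (x : formal_ext E nat) (c e : R) :
  open [set xi : types E nat | `|xi x - c| < e].
Proof.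
rewrite openE => xi /= h.
have := @type_eval_continuous _ _ _ x xi.
move/cvgrPdist_lt => /(_ (e - `|xi x - c|)).
rewrite subr_gt0 => /(_ h); apply: filterS => zeta /= zh.
have -> : zeta x - c = (xi x - c) - (xi x - zeta x) by rewrite opprB [RHS]addrC addrA subrK.
by rewrite (le_lt_trans (ler_normB _ _))// -ltrBrDl.
Qed.

Section Approximation.
Variables (d : E) (e : R).

Definition approximates : set (types E nat) :=
  [set xi | exists n, xi (formal_base nat d - formal_var E n) < e].

Lemma approximates_open : open approximates.
Proof.
rewrite (_ : approximates = \bigcup_n
    [set xi : types E nat | `|xi (formal_base nat d - formal_var E n) - 0| < e]).
  by apply: bigcup_open => n _; exact: open_type_lt.
apply/seteqP; split => [xi [n h]|xi [n _] /=]; [exists n => //=|];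
  by rewrite subr0 ger0_norm ?seminorm_ge0//; exists n.
Qed.

Lemma approximates_dense xi : 0 < e -> closure approximates xi.
Proof.
move=> e0 W /nbhs_free_variables[N NP].
pose a n := if (n < N)%N then gen_var xi n else gen_incl xi d.
pose id_isom := @IsomEmbedding R (gen_space xi) (gen_space xi) idfun
  (fun=> erefl).
exists (tp (isom_comp (gen_incl xi) id_isom) a); split; last first.
  by apply: NP => n nN; rewrite /a nN.
exists N; rewrite /= linearB /= formal_eval_base formal_eval_var /a ltnn /=.
by rewrite subrr normr0.
Qed.

End Approximation.

Section Richness.
Variables (k l : nat) (s : 'I_k -> nat) (K : nat).
Variable w : {ffun grid_index ('I_k + 'I_l)%type K -> nat}.

Definition extension_exists : set (types E nat) :=
  [set xi | exists2 p, coarse w p & extends_tuple (gen_var xi \o s) p].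

Definition extension_realized : set (types E nat) :=
  [set xi | exists2 f : 'I_l -> nat, injective f &
     coarse w (var_norm xi (case_sum s f))].

Lemma extension_realized_open : open extension_realized.
Proof.
rewrite openE => xi [f fI fw].
have near_g g : nbhs xi [set zeta |
    `|var_norm zeta (case_sum s f) (grid_vec R g) - (w g)%:R| < 1].
  have := @open_type_lt
    (combination (@formal_var R E nat \o case_sum s f) (grid_vec R g))
    (w g)%:R 1.
  rewrite openE => /(_ xi); rewrite /= -var_normE => /(_ (fw g)).
  by apply: filterS => zeta /=; rewrite -gen_map_norm linear_combination.
apply: filterS (filter_forall (nbhs_filter xi) near_g) => zeta h.
by exists f => // g; exact: h.
Qed.

(** If the prescribed extension exists, amalgamate it with [gen_space xi] and
    let unused variables denote the new vectors. *)
Lemma extension_realized_dense : extension_exists `<=` closure extension_realized.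
Proof.
move=> xi [p wp /extends_realized[F [j [f fp]]]] W /nbhs_free_variables[N NP].
pose M := maxn N (\max_i s i).+1.
pose a n := if (n < M)%N then j (gen_var xi n) else
  if insub (n - M)%N is Some i then f i else 0.
exists (tp (isom_comp (gen_incl xi) j) a); split; last first.
  by apply: NP => n nN; rewrite /a leq_max nN.
pose fresh (i : 'I_l) := (M + i)%N.
exists fresh => [i i' /addnI /val_inj//|g].
rewrite var_norm_tp.
have -> : tuple_norm (a \o case_sum s fresh) (grid_vec R g)
    = p (grid_vec R g); last exact: wp.
rewrite -fp !tuple_normE; congr `|_|; apply: eq_combination => -[i|i] /=.
  by rewrite /a leq_max orbC ltnS leq_bigmax.
by rewrite /a ltnNge leq_addr /= addKn valK.
Qed.

End Richness.

End Variables.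

(** * Restriction to finitely many variables *)

Section Lift.
Variables (R : realType) (E : normedModType R) (n : nat) (s : 'I_n -> nat).
Hypothesis s_inj : injective s.

(** Let [eta] be close to the restriction of [xi].  Amalgamate [gen_space eta] with
    [gen_space xi], matching up to [d] the variables [s i] and the finitely many
    vectors of [E] that occur in [ys].  The amalgam contains two copies of [E];
    the one in [gen_space eta] becomes the base, the variables [s i] are read in
    [gen_space eta] and the others in [gen_space xi].  The result restricts to
    [eta] exactly and is close to [xi] on [ys]. *)
Lemma lift_near (xi : types E nat) (ys : seq (formal_ext E nat)) (e : R) :
  0 < e ->
  \forall eta \near subtuple s xi,
    exists2 zeta, basic_nbhd xi ys e zeta & subtuple s zeta = eta.
Proof.
move=> e0.
(* Moving the base vector and all variables of [y] by [d] moves [y] by at most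
   [d * size1 y]. *)
pose size1 (y : formal_ext E nat) : R := 1 + \sum_(m <- msupp y.2) `|mcoeff m y.2|.
have size1_ge0 y : 0 <= size1 y by rewrite addr_ge0 ?sumr_ge0.
pose d : R := e / (\sum_(y <- ys) size1 y + 1).
have den0 : 0 < \sum_(y <- ys) size1 y + 1 by rewrite ltr_wpDl ?sumr_ge0.
have d0 : 0 < d by rewrite divr_gt0.
have d_size y : y \in ys -> d * size1 y <= e.
  move=> yys; rewrite mulrAC ler_pdivrMr// ler_wpM2l ?(ltW e0)//.
  rewrite (big_rem y)//= -addrA lerDl addr_ge0//.
  by apply: sumr_ge0 => z _; exact: size1_ge0.
pose v : 'I_(size ys) + 'I_n -> formal_ext E 'I_n :=
  case_sum (fun k => formal_base _ (tnth (in_tuple ys) k).1) (@formal_var R E _).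
pose p (eta : types E 'I_n) := pullback eta (combination v).
have [K K0 Kd] := grid_size_exists (p (subtuple s xi)) d0.
pose tests := [seq combination v (grid_vec R g) |
                g : grid_index ('I_(size ys) + 'I_n)%type K].
apply: filterS (basic_nbhd_nbhs (subtuple s xi) tests (ltr0Sn R 1)) => eta eta_near.
have p_close t : `|p (subtuple s xi) t - p eta t| <= d * l1 t.
  have h (g : grid_index _ K) : `|p (subtuple s xi) (grid_vec R g) - p eta (grid_vec R g)| <= 2.
    rewrite distrC; apply: (eta_near (combination v (grid_vec R g))).
    by apply/fintype.imageP; exists g.
  by apply: le_trans (grid_close K0 h t) _; rewrite ler_wpM2r ?seminorm_ge0.
pose al : {linear ('I_(size ys) + 'I_n -> R) -> gen_space eta} :=
  gen_map eta \o combination v.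
pose be : {linear ('I_(size ys) + 'I_n -> R) -> gen_space xi} :=
  formal_eval (gen_incl xi) (gen_var xi \o s) \o combination v.
pose c : seminorm ('I_(size ys) + 'I_n -> R) := pullback l1 ( *:%R d).
have cE t : c t = d * l1 t by rewrite /= l1_normZ gtr0_norm.
have close t : `| `|al t| - norm_seminorm (gen_space xi) (be t)| <= c t.
  rewrite cE distrC; apply: le_trans (p_close t).
  by rewrite /= gen_map_norm.
have [F [j [Phi [PhiE jPhi]]]] := amalgamation close.
pose a m := if [pick i | s i == m] is Some i then j (gen_var eta i)
            else Phi (gen_var xi m).
have aE i : a (s i) = j (gen_var eta i).
  rewrite /a; case: pickP => [i' /eqP /s_inj ->//|/(_ i)].
  by rewrite eqxx.
exists (tp (isom_comp (gen_incl eta) j) a).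
  move=> y yys; apply: le_trans (d_size y yys).
  have base_close : `|j (gen_incl eta y.1) - Phi (gen_incl xi y.1)| <= d.
    have kP : (index y ys < size ys)%N by rewrite index_mem.
    have := jPhi (unit_coef (inl (Ordinal kP))).
    rewrite cE l1_unit mulr1 /= !combination_unit /= (tnth_nth y) /=.
    by rewrite nth_index// formal_eval_base.
  have var_close m : `|a m - Phi (gen_var xi m)| <= d.
    rewrite /a; case: pickP => [i /eqP <-|_]; last by rewrite subrr normr0 ltW.
    have := jPhi (unit_coef (inr i)).
    by rewrite cE l1_unit mulr1 /= !combination_unit /= formal_eval_var.
  have -> : xi y = `|Phi (gen_map xi y)| by rewrite PhiE /= gen_map_norm.
  apply: le_trans (ler_dist_dist _ _) _.
  rewrite -formal_eval_gen /formal_eval linearD linear_sum opprD addrACA.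
  rewrite -sumrB mulrDr mulr1.
  apply: le_trans (ler_normD _ _) _; apply: lerD => //.
  apply: le_trans (ler_norm_sum _ _ _) _; rewrite mulr_sumr.
  apply: ler_sum => m _; rewrite linearZ /= -scalerBr normrZ mulrC.
  by rewrite ler_wpM2r.
apply: types_eqP => x; rewrite subtuple_tp -[in RHS](tp_gen eta) -(tp_isom _ j).
by apply: tp_agree => i _; exact: aE.
Qed.

(** Restriction to finitely many variables is continuous and open, hence
    pulls nowhere dense sets back to nowhere dense sets. *)
Lemma nowhere_dense_subtuple (A : set (types E 'I_n)) :
  nowhere_dense A -> nowhere_dense (subtuple s @^-1` A).
Proof.
move=> A0; apply: (@nowhere_dense_boundary _ _ (subtuple s @^-1` ~` closure A)).
- apply: open_comp => [xi _|]; first exact: subtuple_continuous.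
  exact/closed_openC/closed_closure.
- move=> xi _ W /nbhs_basic[ys [e e0 eW]].
  have [eta Ieta nA] := nowhere_dense_closure A0 (lift_near xi ys e0).
  have [zeta zW zE] := interior_subset Ieta.
  by exists zeta; split; [rewrite /= zE|exact: eW].
- by move=> xi Axi; apply; exact: subset_closure.
Qed.

End Lift.

(** * Rich types *)

Lemma small_factor (R : realType) (L e : R) :
  0 <= L -> 0 < e -> exists2 d : R, 0 < d & d * L <= e.
Proof.
move=> L0 e0; have L1 : 0 < L + 1 by rewrite ltr_wpDl.
exists (e / (L + 1)); first by rewrite divr_gt0.
by rewrite mulrAC ler_pdivrMr// ler_wpM2l ?(ltW e0)// lerDl.
Qed.

Lemma tuple_norm_dist (R : realType) (I : finType) (G : normedModType R)
    (b b' : I -> G) (u : I -> R) (e : R) :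
  (forall i, `|b i - b' i| <= e) ->
  `|tuple_norm b u - tuple_norm b' u| <= e * l1 u.
Proof.
move=> bb; apply: le_trans (ler_dist_dist _ _) _.
exact: (combination_dist (p := norm_seminorm G)).
Qed.

Section Rich.
Variables (R : realType) (E : completeNormedModType R) (xi : types E nat).

Definition rich : Prop :=
  forall (k l : nat) (s : 'I_k -> nat) (K : nat)
    (w : {ffun grid_index ('I_k + 'I_l)%type K -> nat}),
  extension_exists s w xi -> extension_realized s w xi.

Definition covers_base : Prop :=
  forall (d : E) (e : R), 0 < e -> approximates d e xi.

Let a : nat -> gen_space xi := gen_var xi.

Hypothesis xi_rich : rich.

(** The data [w] of a fine grid determine [p] up to [e]. *)
Lemma rich_extension_var (k l : nat) (s : 'I_k -> nat)
    (p : seminorm ('I_k + 'I_l -> R)) (e : R) :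
  0 < e -> extends_tuple (a \o s) p ->
  exists2 f : 'I_l -> nat, injective f & forall u : 'I_k + 'I_l -> R,
    `|tuple_norm (a \o case_sum s f) u - p u| <= e * l1 u.
Proof.
move=> e0 sp; have [K K0 Ke] := grid_size_exists p e0.
have [w wp] := coarse_exists K p.
have [|f f_inj wf] := xi_rich (s := s) (w := w); first by exists p.
exists f => // u; rewrite distrC; apply: le_trans (coarse_close K0 wp wf u) _.
by rewrite ler_wpM2r ?seminorm_ge0.
Qed.

Hypothesis xi_covers : covers_base.

Let limit_point (g : gen_space xi) := forall e : R, 0 < e ->
  exists n, `|g - a n| <= e.

Let limit_point_var n : limit_point (a n).
Proof. by move=> e e0; exists n; rewrite subrr normr0 ltW. Qed.

(** Prescribing a real combination of [a n] and [a m] as an extension of the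
    pair shows that the variables approximate it. *)
Let limit_pointD (g h : gen_space xi) (c : R) :
  limit_point g -> limit_point h -> limit_point (g + c *: h).
Proof.
move=> gl hl e e0.
have [n gn] := gl (e / 3) ltac:(by rewrite divr_gt0).
have [r r0 rc] := small_factor (normr_ge0 c) (divr_gt0 e0 (ltr0Sn R 2)).
have [m hm] := hl r r0.
pose s (i : 'I_2) := if i == ord0 then n else m.
pose v := a n + c *: a m.
pose t : 'I_2 -> R := fun i => if i == ord0 then 1 else c.
have tv : combination (a \o s) t = v.
  rewrite /combination big_ord_recl big_ord_recl big_ord0 addr0 /t /s /=.
  by rewrite scale1r.
pose p : seminorm ('I_2 + 'I_1 -> R) :=
  tuple_norm (case_sum (a \o s) (fun=> v)).
pose u : 'I_2 + 'I_1 -> R := case_sum t (fun=> -1).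
have [d d0 du] := small_factor (seminorm_ge0 l1 u) (divr_gt0 e0 (ltr0Sn R 2)).
have [|f _ /(_ u)] := @rich_extension_var _ _ s p _ d0.
  exact: extends_tuple_norm.
have comb_u (b : 'I_2 + 'I_1 -> gen_space xi) :
    combination b u = combination (b \o inl) t - b (inr ord0).
  by rewrite /combination big_sumType /= big_ord1 scaleN1r.
rewrite !tuple_normE !comb_u /= !tv subrr normr0 subr0 normr_id => vf.
exists (f ord0).
have {}vf : `|v - a (f ord0)| <= e / 3 by exact: le_trans vf du.
have -> : g + c *: h - a (f ord0)
    = (g - a n) + c *: (h - a m) + (v - a (f ord0)).
  by rewrite /v scalerBr [X in _ = X + _]addrACA -opprD addrA subrK.
have chm : `|c *: (h - a m)| <= e / 3.
  by apply: le_trans rc; rewrite normrZ mulrC ler_wpM2r.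
apply: le_trans (ler_normD _ _) _.
have := ler_normD (g - a n) (c *: (h - a m)); lra.
Qed.

(** Combinations of variables and vectors of [E] are dense in [gen_space xi], and
    limit points of the variables are stable under combinations. *)
Lemma gen_var_approx (g : gen_space xi) (e : R) : 0 < e ->
  exists n, `|g - a n| <= e.
Proof.
move=> e0; have e20 : 0 < e / 2 by rewrite divr_gt0.
have [y gy] := completion_map_approx g e20.
have ylim : limit_point (gen_map xi y).
  rewrite (formal_extE y) linearD linear_sum.
  have baselim : limit_point (gen_map xi (formal_base nat y.1)).
    move=> d d0; have [n nd] := xi_covers y.1 d0.
    by exists n; rewrite -gen_map_norm linearB in nd; exact: ltW.
  elim: (enum_fset _) => [|m q IH]; first by rewrite big_nil addr0.
  rewrite big_cons addrCA addrC linearZ; apply: limit_pointD => //.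
  exact: limit_point_var.
have [n yn] := ylim _ e20; exists n.
have -> : g - a n = (g - gen_map xi y) + (gen_map xi y - a n).
  by rewrite addrA subrK.
apply: le_trans (ler_normD _ _) _; move: gy; rewrite -/(gen_map xi y) => gy.
by rewrite [leRHS]splitr lerD.
Qed.

(** The tuple [g] need not consist of variables: it is close to a tuple of
    variables [s], and moving [g] inside an extension where [p] is realized
    moves [p] just as little. *)
Lemma rich_extension (k l : nat) (g : 'I_k -> gen_space xi)
    (p : seminorm ('I_k + 'I_l -> R)) (e : R) :
  0 < e -> extends_tuple g p ->
  exists2 f : 'I_l -> nat, injective f & forall u : 'I_k + 'I_l -> R,
    `|tuple_norm (case_sum g (a \o f)) u - p u| <= e * l1 u.
Proof.
move=> e0 gp; have e30 : 0 < e / 3 by rewrite divr_gt0.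
have /choice[s sP] i := gen_var_approx (g i) e30.
have [F [j [h hp]]] := extends_realized gp.
pose p' := tuple_norm (case_sum (j \o (a \o s)) h).
have sp : extends_tuple (a \o s) p'.
  apply: extends_tuple_norm => t.
  by rewrite -(isom_embeddingE j) linear_combination.
have [f f_inj fP] := rich_extension_var e30 sp.
exists f => // u.
have c1 : `|tuple_norm (case_sum g (a \o f)) u
    - tuple_norm (a \o case_sum s f) u| <= e / 3 * l1 u.
  apply: tuple_norm_dist => -[i|i] /=; first exact: sP.
  by rewrite subrr normr0 ltW.
have c2 : `|p' u - p u| <= e / 3 * l1 u.
  rewrite -hp; apply: tuple_norm_dist => -[i|i] /=.
    by rewrite -linearB isom_embeddingE distrC.
  by rewrite subrr normr0 ltW.
move: c1 c2 (fP u); rewrite !ler_norml.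
by move=> /andP[? ?] /andP[? ?] /andP[? ?]; apply/andP; split; lra.
Qed.

(** Ask for an extension of [b] by a second copy of itself. *)
Lemma injective_approx (n : nat) (b : 'I_n -> gen_space xi) (e : R) :
  0 < e -> exists2 f : 'I_n -> nat, injective f &
    forall i, `|b i - a (f i)| <= e.
Proof.
move=> e0; have e20 : 0 < e / 2 by rewrite divr_gt0.
pose p : seminorm ('I_n + 'I_n -> R) := tuple_norm (case_sum b b).
have [|f f_inj fP] := @rich_extension _ _ b p _ e20.
  exact: extends_tuple_norm.
exists f => // i.
pose u : 'I_n + 'I_n -> R := unit_coef (inl i) - unit_coef (inr i).
have comb_u (c : 'I_n + 'I_n -> gen_space xi) :
    combination c u = c (inl i) - c (inr i).
  by rewrite linearB /= !combination_unit.
have := fP u; rewrite !tuple_normE !comb_u /= subrr normr0 subr0 normr_id.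
move=> /le_trans; apply; rewrite -ler_pdivlMl// invf_div divfK ?gt_eqF//.
apply: le_trans (seminormD l1 _ _) _.
by rewrite -scaleN1r seminormZ normrN1 mul1r !l1_unit.
Qed.

Lemma gen_space_separable : separable (gen_space xi).
Proof.
exists (range a); first exact: sub_countable (card_image_le _ _) _.
move=> O [g Og] oO; have /nbhs_ballP[e /= e0 eO] := open_nbhs_nbhs (conj oO Og).
have [n gn] := gen_var_approx g (divr_gt0 e0 (ltr0Sn R 1)).
exists (a n); split; last by exists n.
apply: eO; rewrite -ball_normE /=; apply: le_lt_trans gn _.
by rewrite ltr_pdivrMr// ltr_pMr// ltr1n.
Qed.

(** A realisation of a type in [X] is close to a tuple of distinct variables,
    whose type is in [X] as well because [X] is metrically open. *)
Lemma rich_omits (n : nat) (X : set (types E 'I_n)) :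
  metrically_open X ->
  (forall f : 'I_n -> nat, injective f -> ~ X (subtuple f xi)) ->
  omits (gen_incl xi) X.
Proof.
move=> oX nX b Xb; have [e e0 eX] := oX _ Xb.
have [f f_inj fP] := injective_approx b (divr_gt0 e0 (ltr0Sn R 1)).
apply: (nX f f_inj); apply: eX.
apply: le_lt_trans (_ : e / 2 < e); last first.
  by rewrite ltr_pdivrMr// ltr_pMr// ltr1n.
apply: le_trans (_ : \big[Num.max/0]_(i < n) `|b i - a (f i)| <= _).
  apply: ge_inf; last by exists (gen_space xi), (gen_incl xi), b, (a \o f).
  exists 0 => _ [F [j [b1 [b2 [_ _ ->]]]]].
  by elim/big_ind : _ => // x y x0 y0; rewrite le_max x0.
apply/bigmax_leP; split => [|i _]; last exact: fP.
by rewrite divr_ge0// ltW.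
Qed.

End Rich.

(** * Finite-dimensional spaces *)

Section FiniteDim.
Variables (R : realType) (B : normedModType R).

(** A spanning family of least size is a basis. *)
Lemma finite_dim_free : finite_dim B ->
  exists (n : nat) (b : 'I_n -> B),
    (forall x, exists c, x = combination b c) /\
    (forall c, combination b c = 0 -> c = 0).
Proof.
move=> B_fin.
have ex_n : exists n, `[< exists b : 'I_n -> B,
    forall x, exists c, x = combination b c >].
  by have [n [b bP]] := B_fin; exists n; apply/asboolP; exists b.
case: (ex_minnP ex_n) => n /asboolP[b bP] n_min; exists n, b; split=> // c c0.
apply/funext => i; apply: contrapT => /eqP ci.
case: n b bP n_min c c0 i ci => [b _ _ _ _ []//|n b bP n_min c c0 i ci].
suff : (n.+1 <= n)%N by rewrite ltnn.
apply: n_min; apply/asboolP; exists (b \o lift i) => x.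
have bi : b i = - \sum_(k < n) ((c i)^-1 * c (lift i k)) *: b (lift i k).
  have := congr1 ( *:%R (c i)^-1) c0.
  rewrite scaler0 /combination (bigD1_ord i)//= scalerDr scalerA mulVf//.
  rewrite scale1r scaler_sumr => /eqP; rewrite addr_eq0 => /eqP ->.
  by congr (- _); apply: eq_bigr => k _; rewrite scalerA.
have [d ->] := bP x.
exists (fun k => d (lift i k) - d i * ((c i)^-1 * c (lift i k))).
rewrite /combination (bigD1_ord i)//= {1}bi scalerN scaler_sumr addrC -sumrB.
by apply: eq_bigr => k _; rewrite scalerBl scalerA.
Qed.

(** On a finite-dimensional space the coordinates are bounded, as the norm has a
    positive minimum on the compact unit sphere of the coefficient space. *)
Lemma free_bounded (n : nat) (b : 'I_n -> B) :
  (forall c, combination b c = 0 -> c = 0) ->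
  exists2 C : R, 0 <= C & forall c, l1 c <= C * `|combination b c|.
Proof.
move=> b_free.
case: n b b_free => [b _|n b b_free].
  by exists 0 => // c; rewrite /= /l1_norm big_ord0 mul0r.
pose coef (v : 'rV[R]_n.+1) : 'I_n.+1 -> R := fun i => v ord0 i.
pose N (v : 'rV[R]_n.+1) := `|combination b (coef v)|.
pose S := [set v : 'rV[R]_n.+1 | `|v| = 1].
have coef_le v i : `|coef v i| <= `|v|.
  rewrite [leRHS]/Num.norm /= mx_normrE; apply/bigmax_geP; right => /=.
  by exists (ord0, i).
pose D := \sum_i `|b i|.
have D0 : 0 <= D by exact: sumr_ge0.
have N_lip v w : `|N v - N w| <= D * `|v - w|.
  apply: le_trans (ler_dist_dist _ _) _; rewrite -linearB /=.
  apply: le_trans (seminorm_sum (norm_seminorm B) _) _.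
  rewrite mulr_suml; apply: ler_sum => i _ /=.
  rewrite normrZ mulrC ler_wpM2l//; apply: le_trans (coef_le (v - w) i).
  by rewrite /coef !mxE !fctE.
have N_cont : continuous N.
  move=> v; apply/(@cvgrPdist_le _ _ _ (nbhs v) (nbhs_filter v)) => e e0.
  have [d d0 dD] : exists2 d : R, 0 < d & d * D <= e.
    exact: small_factor.
  have nv : nbhs v [set w | `|v - w| <= d].
    by apply/nbhs_ballP; exists d => //= w; rewrite -ball_normE /= => /ltW.
  apply: filterS nv => w vw; apply: le_trans (N_lip v w) _.
  by apply: le_trans dD; rewrite mulrC ler_wpM2r.
have S_compact : compact S.
  apply: bounded_closed_compact.
    exists 1; split => // x x1 v /= ->; exact: ltW.
  apply: (@closed_comp _ _ (fun v : 'rV[R]_n.+1 => `|v|) [set 1]).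
    by move=> v _; exact: norm_continuous.
  exact: closed_eq.
have S0 : S !=set0.
  exists (const_mx 1); apply/eqP; rewrite /S /= eq_le; apply/andP; split.
    rewrite [leLHS]/Num.norm /= mx_normrE; apply/bigmax_leP; split => // i _.
    by rewrite mxE normr1.
  have := coef_le (const_mx 1) ord0.
  by rewrite /coef mxE normr1.
have [v /set_mem vS vmin] := compact_EVT_min S0 S_compact
  (continuous_subspaceT N_cont).
have v0 : 0 < N v.
  rewrite lt_def normr_ge0 andbT normr_eq0; apply/eqP => /b_free cv.
  have : v = 0.
    by apply/rowP => i; rewrite mxE; exact: (congr1 (fun f => f i) cv).
  by move=> v0; move: vS; rewrite /S /= v0 normr0 => /eqP; rewrite eq_sym oner_eq0.
exists (n.+1%:R / N v); first by rewrite divr_ge0// ltW.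
move=> c; pose w : 'rV[R]_n.+1 := \row_i c i.
have cE : c = coef w by apply/funext => i; rewrite /coef mxE.
have [w0|w0] := eqVneq w 0.
  have -> : c = 0 by rewrite cE w0; apply/funext => i; rewrite /coef mxE.
  by rewrite seminorm0 mulr_ge0// divr_ge0// ltW.
have wpos : 0 < `|w| by rewrite normr_gt0.
have wN : N v * `|w| <= `|combination b c|.
  have := vmin (`|w|^-1 *: w).
  have -> : N (`|w|^-1 *: w) = `|w|^-1 * N w.
    rewrite /N -[in RHS](gtr0_norm (_ : 0 < `|w|^-1)) ?invr_gt0//.
    rewrite -normrZ -linearZ /=; congr `|combination b _|.
    by apply/funext => i; rewrite /coef mxE.
  rewrite ler_pdivlMl// mulrC cE; apply; apply/mem_set.
  by rewrite /S /= normrZ normfV normr_id mulVf// gt_eqF.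
apply: le_trans (_ : n.+1%:R * `|w| <= _).
  rewrite /= /l1_norm; apply: le_trans (_ : \sum_(i < n.+1) `|w| <= _).
    by apply: ler_sum => i _; rewrite cE.
  by rewrite sumr_const card_ord mulr_natl.
by rewrite -mulrA ler_wpM2l// ler_pdivlMl.
Qed.

Record coordinates : Type := Coordinates {
  basis_size : nat ;
  basis_vec : 'I_basis_size -> B ;
  basis_coord : {linear B -> ('I_basis_size -> R)} ;
  coord_bound : R ;
  basis_coordK : forall x, combination basis_vec (basis_coord x) = x ;
  coord_bound_ge0 : 0 <= coord_bound ;
  basis_coord_le : forall x, l1 (basis_coord x) <= coord_bound * `|x| }.

Lemma finite_dim_coordinates : finite_dim B -> inhabited coordinates.
Proof.
move=> /finite_dim_free[n [b [b_span b_free]]].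
have [C C0 bC] := free_bounded b_free.
have /choice[c cP] := b_span.
have cK t : c (combination b t) = t.
  apply/eqP; rewrite -subr_eq0; apply/eqP/b_free.
  by rewrite linearB /= -cP subrr.
have c_lin : linear c.
  by move=> a x y; rewrite {1}(cP x) {1}(cP y) -linearP cK.
pose cl : {linear B -> ('I_n -> R)} :=
  HB.pack c (GRing.isLinear.Build _ _ _ _ c c_lin).
split; apply: (@Coordinates n b cl C) => //.
by move=> x; rewrite {2}(cP x).
Qed.

End FiniteDim.

Arguments basis_vec {R B} c _ : rename.
Arguments basis_coord {R B} c.
Arguments basis_coordK {R B} c x.
Arguments basis_coord_le {R B} c x.

(** A finite-dimensional space is a linear retract of every finite-dimensional
    space that contains it. *)
Lemma linear_retraction (R : realType) (A B : normedModType R)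
    (i : isom_embedding A B) : finite_dim A -> finite_dim B ->
  exists P : {linear B -> A}, forall x, P (i x) = x.
Proof.
(* In coordinates [i] is right multiplication by [M], and a generalized inverse of
   [M] is a retraction because [i] is injective. *)
move=> /finite_dim_coordinates[cA] /finite_dim_coordinates[cB].
pose row (n : nat) (t : 'I_n -> R) : 'rV[R]_n := \row_k t k.
pose M : 'M[R]_(basis_size cA, basis_size cB) :=
  \matrix_(k, m) basis_coord cB (i (basis_vec cA k)) m.
pose Q (t : 'I_(basis_size cB) -> R) : 'I_(basis_size cA) -> R :=
  fun k => (row _ t *m pinvmx M) ord0 k.
have Q_lin : linear Q.
  move=> a s t; apply/funext => k; rewrite !fctE /Q /row.
  have -> : \row_m (a *: s + t) m = a *: (\row_m s m) + \row_m t m :> 'rV[R]__.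
    by apply/rowP => m; rewrite !mxE.
  by rewrite mulmxDl -scalemxAl !mxE.
pose QL : {linear ('I_(basis_size cB) -> R) -> ('I_(basis_size cA) -> R)} :=
  HB.pack Q (GRing.isLinear.Build _ _ _ _ Q Q_lin).
have coord_i t : row _ (basis_coord cB (i (combination (basis_vec cA) t)))
    = row _ t *m M.
  apply/rowP => m; rewrite !mxE !linear_combination /combination fct_sumE.
  by apply: eq_bigr => k _; rewrite !mxE.
exists (combination (basis_vec cA) \o (QL \o basis_coord cB)) => x.
have i_inj : injective i.
  move=> y z yz; apply/eqP; rewrite -subr_eq0 -normr_eq0.
  by rewrite -(isom_embeddingE i) linearB yz subrr normr0.
apply: i_inj; rewrite -[LHS](basis_coordK cB) -[RHS](basis_coordK cB).
congr combination; apply/funext => m.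
have rowE (n : nat) (t : 'I_n -> R) k : t k = row n t ord0 k by rewrite mxE.
rewrite rowE [RHS]rowE coord_i -[in RHS](basis_coordK cA x) coord_i.
have -> : row _ (Q (basis_coord cB (i x))) = row _ (basis_coord cB (i x)) *m pinvmx M.
  by apply/rowP => k; rewrite mxE.
have -> : row _ (basis_coord cB (i x)) = row _ (basis_coord cA x) *m M.
  by rewrite -coord_i basis_coordK.
by rewrite mulmxKpV ?submxMl.
Qed.

(** * Rich types are Gurarij types *)

(** Let [phi] embed [A] in [gen_space xi] and let [P] retract [B] on [A].
    Prescribing a copy of a basis of [B] over the images under [phi \o P] of this
    basis gives variables spanning an almost isometric copy of [B] on which [A]
    lies almost as [phi] says; a small correction through [P] makes this
    exact. *)
Lemma rich_gurarij (R : realType) (E : completeNormedModType R)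
    (xi : types E nat) : rich xi -> covers_base xi -> gurarij_type xi.
Proof.
move=> xi_rich xi_covers e A B i phi e0 A_fin B_fin.
have [P PK] := linear_retraction i A_fin B_fin.
have [cB] := finite_dim_coordinates B_fin.
pose b := basis_vec cB; pose C := coord_bound cB.
have C0 : 0 <= C := coord_bound_ge0 cB.
pose g k := phi (P (b k)).
pose p : seminorm ('I_(basis_size cB) + 'I_(basis_size cB) -> R) :=
  tuple_norm (case_sum (fun k => i (P (b k))) b).
have gp : extends_tuple g p.
  apply: extends_tuple_norm => t.
  have -> : combination g t = phi (P (combination b t)).
    by rewrite !linear_combination.
  rewrite isom_embeddingE -(isom_embeddingE i) !linear_combination.
  by congr `|_|; exact: eq_combination.
pose D := \sum_k `|P (b k)|.
have D0 : 0 <= D by exact: sumr_ge0.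
have P_le x : `|P x| <= D * (C * `|x|).
  rewrite -{1}(basis_coordK cB x) linear_combination.
  apply: le_trans (_ : D * l1 (basis_coord cB x) <= _); last first.
    by rewrite ler_wpM2l// basis_coord_le.
  apply: (seminorm_combination (p := norm_seminorm A)) => k /=.
  by rewrite /D (bigD1 k)//= lerDl sumr_ge0.
have L0 : 0 <= C + (C + C * (D * C)) by rewrite !addr_ge0 ?mulr_ge0.
have [d d0 dL] := small_factor L0 e0.
have [f _ fP] := rich_extension xi_rich xi_covers d0 gp.
pose psi0 : {linear B -> gen_space xi} :=
  combination (gen_var xi \o f) \o basis_coord cB.
pose psi : {linear B -> gen_space xi} :=
  psi0 \+ ((phi \o P) \- (psi0 \o (i \o P))).
have comb_sum (V : lmodType R) (v w : 'I_(basis_size cB) -> V)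
    (s t : 'I_(basis_size cB) -> R) :
  combination (case_sum v w) (case_sum s t) = combination v s + combination w t.
  by rewrite /combination big_sumType.
have l1_sum (s t : 'I_(basis_size cB) -> R) :
    l1 (case_sum s t) = l1 s + l1 t.
  by rewrite /= /l1_norm big_sumType.
have psi0_norm x : `| `|psi0 x| - `|x| | <= d * (C * `|x|).
  have := fP (case_sum 0 (basis_coord cB x)).
  rewrite !tuple_normE !comb_sum !linear0 !add0r basis_coordK l1_sum seminorm0 add0r.
  move=> h; apply: le_trans h _; rewrite ler_wpM2l ?(ltW d0)//.
  exact: basis_coord_le.
have err x : `|phi (P x) - psi0 (i (P x))| <= d * ((C + C * (D * C)) * `|x|).
  have := fP (case_sum (basis_coord cB x) (- basis_coord cB (i (P x)))).
  rewrite !tuple_normE !comb_sum l1_sum seminormN !linearN /= basis_coordK.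
  have -> : combination (fun k => i (P (b k))) (basis_coord cB x) = i (P x).
    by rewrite -[in RHS](basis_coordK cB x) !linear_combination.
  have -> : combination g (basis_coord cB x) = phi (P x).
    by rewrite -[in RHS](basis_coordK cB x) !linear_combination.
  rewrite subrr normr0 subr0 normr_id.
  move=> h; apply: le_trans h _; rewrite ler_wpM2l ?(ltW d0)//.
  rewrite mulrDl lerD ?basis_coord_le//; apply: le_trans (basis_coord_le cB _) _.
  by rewrite isom_embeddingE -!mulrA ler_wpM2l.
exists psi; split=> x; first by rewrite /psi /= PK addrC subrK.
have psiE : psi x = psi0 x + (phi (P x) - psi0 (i (P x))) by [].
have tot : `| `|psi x| - `|x| | <= e * `|x|.
  have h : d * (C * `|x|) + d * ((C + C * (D * C)) * `|x|) <= e * `|x|.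
    by rewrite -mulrDr -mulrDl mulrA ler_wpM2r.
  apply: le_trans h; apply: le_trans (lerD (psi0_norm x) (err x)).
  have := ler_normD (psi0 x) (phi (P x) - psi0 (i (P x))).
  have := lerB_normD (psi0 x) (phi (P x) - psi0 (i (P x))).
  rewrite -psiE; move: (`|psi x|) (`|psi0 x|) (`|_ - _|) (`|x|) => u v w z h1 h2.
  rewrite ler_norml; have := ler_norm (v - z); have := ler_norm (z - v).
  by rewrite distrC => h3 h4; apply/andP; split; lra.
move: tot; rewrite ler_norml => /andP[h1 h2].
by apply/andP; split; lra.
Qed.

(** * The space of types is a Baire space *)

Section Baire.
Variables (R : realType) (E : normedModType R).

Let zero_type : types E nat :=
  tp (@IsomEmbedding R E E idfun (fun=> erefl)) (fun=> 0).

Lemma type_le_vars (xi : types E nat) (y : formal_ext E nat) :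
  xi y <= `|y.1| + \sum_(i <- msupp y.2) `|mcoeff i y.2| * xi (formal_var E i).
Proof.
rewrite [in leLHS](formal_extE y).
apply: le_trans (seminormD _ _ _) _; rewrite type_ext lerD2l.
elim: (enum_fset _) => [|i q IH]; first by rewrite !big_nil seminorm0.
by rewrite !big_cons (le_trans (seminormD _ _ _))// seminormZ lerD2l.
Qed.

Lemma ultrafilter_map (S T : Type) (f : S -> T) (U : set_system S) :
  UltraFilter U -> UltraFilter (f @ U).
Proof.
move=> UU; have FU : ProperFilter U by exact: ultra_proper.
split=> [|G GG UG]; first exact: fmap_proper_filter.
apply/seteqP; split=> // A GA.
have [//|UnA] := in_ultra_setVsetC (f @^-1` A) UU.
have GnA : G (~` A) by exact: UG.
by have [x []] := filter_ex (filterI GA GnA).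
Qed.

(** Each coordinate of the sequence is bounded on a large set, hence converges
    along the ultrafilter; the limits form a type. *)
Lemma ultrafilter_limit (u : nat -> types E nat) (U : set_system nat) :
  UltraFilter U ->
  (forall i, exists C, U [set k | u k (formal_var E i) <= C]) ->
  exists xi : types E nat, forall (y : formal_ext E nat) (c e : R),
    U [set k | `|u k y - c| <= e] -> `|xi y - c| <= e.
Proof.
move=> UU /choice[C UC].
have FU : ProperFilter U by exact: ultra_proper.
have lim_ex (y : formal_ext E nat) : exists l : R, u k y @[k --> U] --> l.
  pose M := `|y.1| + \sum_(i <- msupp y.2) `|mcoeff i y.2| * C i.
  have UM : U [set k | `[(0 : R), M]%classic (u k y)].
    have : U (\bigcap_(i in [set` msupp y.2]) [set k | u k (formal_var E i) <= C i]).
      by apply: filter_bigI => i _; exact: UC.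
    apply: filterS => k h; rewrite /= in_itv /= seminorm_ge0 /=.
    apply: le_trans (type_le_vars _ _) _; rewrite lerD2l big_seq [leRHS]big_seq.
    by apply: ler_sum => i iy; rewrite ler_wpM2l//; exact: h.
  have := @segment_compact R 0 M; rewrite compact_ultra.
  move=> /(_ _ (ultrafilter_map (fun k => u k y) UU) UM)[l [_ ul]].
  by exists l.
have /choice[L LP] := lim_ex.
have LD x y : L (x + y) <= L x + L y.
  apply: (ler_cvg_to (LP (x + y)) (cvgD (LP x) (LP y))).
  by apply: nearW => k; exact: seminormD.
have LZ (a : R) x : L (a *: x) = `|a| * L x.
  apply: (@cvg_unique _ (@Rhausdorff R) _ _ _ _ (LP (a *: x))).
  have -> : (fun k => u k (a *: x)) = (fun k => `|a| * u k x).
    by apply/funext => k; rewrite seminormZ.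
  exact: cvgMr (LP x).
have LE b : L (formal_base nat b) = `|b|.
  apply: (@cvg_unique _ (@Rhausdorff R) _ _ _ _ (LP _)).
  have -> : (fun k => u k (formal_base nat b)) = cst `|b|.
    by apply/funext => k; rewrite type_ext.
  exact: cvg_cst.
exists (@Types R E nat (Seminorm LD LZ) LE) => y c e Ue /=.
have Lc : `|u k y - c| @[k --> U] --> `|L y - c|.
  by apply: cvg_norm; apply: cvgB => //; exact: cvg_cst.
exact: (ler_cvg_to Lc (cvg_cst e)).
Qed.

(** The type space is a Baire space: the sets [A k] are avoided one after the
    other inside shrinking neighbourhoods [basic_nbhd]; at step [k] the variable
    of index [k] joins the tested vectors, so that the centres are bounded on
    every variable. *)
Theorem types_baire (A : nat -> set (types E nat)) :
  (forall k, nowhere_dense (A k)) -> exists xi, forall k, ~ A k xi.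
Proof.
move=> A0.
pose stage : Type := (types E nat * seq (formal_ext E nat) * {posnum R})%type.
pose nb (D : stage) := basic_nbhd D.1.1 D.1.2 D.2%:num.
have next k (D : stage) : exists D' : stage,
    [/\ nb D' `<=` nb D, nb D' `<=` ~` A k & formal_var E k \in D'.1.2].
  have [zeta Dz Az] := nowhere_dense_closure (A0 k)
    (basic_nbhd_nbhs D.1.1 D.1.2 (gt0 D.2)).
  have : nbhs zeta (nb D `&` ~` A k).
    apply: filterI; first exact: Dz.
    apply: filterS (open_nbhs_nbhs (conj (closed_openC (@closed_closure _ (A k))) Az)).
    by move=> x nx Ax; apply: nx; exact: subset_closure.
  move=> /nbhs_basic[ys [e e0 eW]].
  exists (zeta, formal_var E k :: ys, PosNum e0); split.
  - by move=> x h; apply: (eW _ _).1 => y yys; apply: h; rewrite in_cons yys orbT.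
  - by move=> x h; apply: (eW _ _).2 => y yys; apply: h; rewrite in_cons yys orbT.
  - by rewrite in_cons eqxx.
have /choice[F FP] : forall kD : nat * stage, exists D' : stage,
    [/\ nb D' `<=` nb kD.2, nb D' `<=` ~` A kD.1 &
        formal_var E kD.1 \in D'.1.2] by move=> [k D]; exact: next.
pose D := fix D k : stage := if k is k'.+1 then F (k', D k')
  else (zero_type, [::], PosNum (@ltr01 R)).
have D_mono m k : (m <= k)%N -> nb (D k) `<=` nb (D m).
  elim: k => [|k IH]; first by rewrite leqn0 => /eqP ->.
  rewrite leq_eqVlt => /orP[/eqP ->//|/IH]; apply: subset_trans.
  by have [] := FP (k, D k).
pose u k := (D k).1.1.
have u_nb k : nb (D k) (u k).
  by move=> y _; rewrite subrr normr0.
have [U [UU sU]] := @ultraFilterLemma nat \oo _.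
have u_in m : U [set k | nb (D m) (u k)].
  by apply: sU; exists m => // k /= mk; exact: D_mono mk _ (u_nb k).
have bounded i : exists C, U [set k | u k (formal_var E i) <= C].
  exists (u i.+1 (formal_var E i) + (D i.+1).2%:num).
  apply: filterS (u_in i.+1) => k /(_ (formal_var E i)).
  have [_ _ h] := FP (i, D i); move=> /(_ h).
  by rewrite ler_norml => /andP[_]; rewrite lerBlDl.
have [xi xiP] := ultrafilter_limit UU bounded.
have xi_nb m : nb (D m) xi.
  by move=> y yD; apply: xiP; apply: filterS (u_in m) => k; exact.
by exists xi => k; have [_ h _] := FP (k, D k); apply: h; exact: (xi_nb k.+1).
Qed.

End Baire.

(** * Omitting types *)

Lemma separable_sequence (R : realType) (E : normedModType R) :
  separable E ->
  exists c : nat -> E, forall (x : E) (e : R), 0 < e ->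
    exists n, `|x - c n| < e.
Proof.
move=> [A /countable_injP[f f_inj] A_dense].
exists (fun n => xget 0 [set x | A x /\ f x = n]) => x e e0.
have [y [xy Ay]] : (ball x e `&` A) !=set0.
  apply: A_dense; last exact: ball_open.
  by exists x; exact: ballxx.
exists (f y); case: xgetP => [z _ [Az fz]|/(_ y)[]//].
have -> : z = y by apply: f_inj => //; exact/mem_set.
by move: xy; rewrite -ball_normE.
Qed.

Section Conditions.
Variables (R : realType) (E : completeNormedModType R).
Variables (c : nat -> E) (A : forall n, nat -> set (types E 'I_n)).

(** The three summands index the exceptions to [covers_base], to [rich] and to the
    omission of the types in the sets [A n m] by distinct variables.  All three
    are countable, since tuples of variables and grid data are. *)
Definition condition_index : countType :=
  (nat * nat
   + {k : nat & {l : nat & {K : nat &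
       ({ffun 'I_k -> nat} *
        {ffun grid_index ('I_k + 'I_l)%type K -> nat})%type}}}
   + {n : nat & ({ffun 'I_n -> nat} * nat)%type})%type.

Definition exceptions (i : condition_index) : set (types E nat) :=
  match i with
  | inl (inl (n, m)) => ~` approximates (c n) (m.+1%:R^-1)
  | inl (inr (existT k (existT l (existT K (s, w))))) =>
      extension_exists (s : 'I_k -> nat) w `\` extension_realized s w
  | inr (existT n (s, m)) =>
      [set xi | injective s /\ @A n m (subtuple s xi)]
  end.

Lemma exceptions_nowhere_dense :
  (forall n m, nowhere_dense (@A n m)) ->
  forall i, nowhere_dense (exceptions i).
Proof.
move=> A0 [[[n m]|[k [l [K [s w]]]]]|[n [s m]]] /=.
- apply: (@nowhere_dense_boundary _ _ (approximates (c n) m.+1%:R^-1)) => //.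
    exact: approximates_open.
  by move=> xi _; apply: approximates_dense; rewrite invr_gt0.
- apply: (@nowhere_dense_boundary _ _ (extension_realized s w)).
  + exact: extension_realized_open.
  + by move=> xi [h _]; exact: extension_realized_dense.
  + by move=> xi [].
- have [s_inj|s_ninj] := pselect (injective s).
    apply: nowhere_dense_sub (nowhere_dense_subtuple s_inj (A0 n m)).
    by move=> xi [].
  rewrite (_ : [set _ | _] = set0) /nowhere_dense ?closure0 ?interior0//.
  by apply/seteqP; split => // xi [].
Qed.

Hypothesis c_dense :
  forall (x : E) (e : R), 0 < e -> exists n, `|x - c n| < e.

Variable xi : types E nat.
Hypothesis xi_ok : forall i, ~ exceptions i xi.

Lemma unexceptional_covers : covers_base xi.
Proof.
move=> d e e0; have e20 : 0 < e / 2 by rewrite divr_gt0.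
have [n dn] := c_dense d e20.
have /cvgr0Pnorm_lt/(_ _ e20)[m _ /(_ m (leqnn m)) me] := @cvg_harmonic R.
have /contrapT[k ck] := @xi_ok (inl (inl (n, m))); exists k.
have -> : formal_base nat d - formal_var E k
    = formal_base nat (d - c n) + (formal_base nat (c n) - formal_var E k).
  rewrite addrA; congr (_ - _); apply/pair_equal_spec; split => /=.
    by rewrite subrK.
  by rewrite addr0.
apply: le_lt_trans (seminormD _ _ _) _; rewrite type_ext [ltRHS]splitr.
by apply: ltrD => //; apply: lt_trans ck _; apply: le_lt_trans me; exact: ler_norm.
Qed.

Lemma unexceptional_rich : rich xi.
Proof.
move=> k l s K w xi_ext; apply: contrapT => xi_nreal.
have sE : (finfun s : 'I_k -> nat) = s by apply/funext => i; rewrite ffunE.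
apply: (@xi_ok (inl (inr (existT _ k (existT _ l (existT _ K (finfun s, w))))))).
by rewrite /= sE.
Qed.

Lemma unexceptional_omits (n : nat) (X : set (types E 'I_n)) :
  metrically_open X -> X = \bigcup_m @A n m -> omits (gen_incl xi) X.
Proof.
move=> oX XA; apply: (rich_omits unexceptional_rich unexceptional_covers oX).
move=> s s_inj; rewrite XA => -[m _ Am].
have sE : (finfun s : 'I_n -> nat) = s by apply/funext => i; rewrite ffunE.
by apply: (@xi_ok (inr (existT _ n (finfun s, m)))); rewrite /= sE.
Qed.

End Conditions.

Theorem theorem2p12 (R : realType) (E : completeNormedModType R)
    (X : forall n : nat, set (types E 'I_n)) :
  separable E ->
  (forall n : nat, metrically_open (X n)) ->
  (forall n : nat, meagre (X n)) ->
  (exists (G : completeNormedModType R) (j : isom_embedding E G),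
      [/\ separable G, gurarij G & forall n : nat, omits j (X n)]) /\
  comeagre [set xi : types E nat |
      [/\ gurarij_type xi, separable (gen_space xi) &
          forall n : nat, omits (gen_incl xi) (X n)]].
Proof.
move=> /separable_sequence[c c_dense] X_open X_meagre.
pose A n := sval (cid (X_meagre n)).
have AX n := svalP (cid (X_meagre n)).
pose S := [set xi : types E nat | [/\ gurarij_type xi, separable (gen_space xi) &
  forall n : nat, omits (gen_incl xi) (X n)]].
have S_comeagre : comeagre S.
  apply: (meagre_cover (exceptions_nowhere_dense c (fun n => (AX n).1))).
  move=> xi nSxi; apply: contrapT => xi_nex; apply: nSxi.
  have xi_ok i : ~ exceptions c A i xi by move=> ex; apply: xi_nex; exists i.
  have xi_rich := unexceptional_rich xi_ok.
  have xi_covers := unexceptional_covers c_dense xi_ok.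
  split; first exact: rich_gurarij.
    exact: gen_space_separable.
  by move=> n; apply: (unexceptional_omits c_dense xi_ok) (X_open n) (AX n).2.
split=> //; have [F [F0 SF]] := S_comeagre.
have [xi xiF] := types_baire F0.
have [xi_gur xi_sep xi_omits] : S xi.
  apply: contrapT => nS; have : (~` S) xi := nS.
  by rewrite SF => -[k _ /xiF].
by exists (gen_space xi), (gen_incl xi).
Qed.
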